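(* Let $\phi:\Omega\to\mathbb{R}$ be a continuous potential satisfying Walters' condition, and suppose that $\phi$ satisfies one of the following conditions (as $n\to\infty$): (1) $W_n(\phi)=O(\theta^n)$; (2) $W_n(\phi)=O(n^{-\alpha})$ for some $\alpha>1$; (3) $W_n(\phi)=O(\eta^{(\log n)^{\alpha}})$ for some $\eta\in(0,1)$ and $\alpha>1$; (4) $W_n(\phi)=O(e^{-cn^{\alpha}})$ for some $c>0$ and $\alpha\in(0,1)$. Let $\mu_\phi$ be the unique equilibrium state of $\phi$. Then there exists a constant $C>0$ such that for every $n\ge 1$ and every separately $d_\theta$-Lipschitz function $K:\Omega^n\to\mathbb{R}$, $$\int \exp\big(K(x,Tx,\dots,T^{n-1}x)\big)\,d\mu_\phi(x)\le \exp\Big(\int K(x,Tx,\dots,T^{n-1}x)\,d\mu_\phi(x)\Big)\exp\Big(C\sum_{j=0}^{n-1}\mathrm{Lip}_{\theta,j}(K)^2\Big).$$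
   Context: $A$ is a finite alphabet, $\mathbb{N}=\{0,1,2,\dots\}$, $\Omega=A^{\mathbb{N}}$ with points $x=x^0x^1x^2\cdots$, and $T:\Omega\to\Omega$ is the shift $(Tx)^k=x^{k+1}$. Fix $\theta\in(0,1)$ and put $d_\theta(x,y)=\theta^{\inf\{k:\,x^k\ne y^k\}}$ (with $d_\theta(x,x)=0$). Measures are Borel. For $\phi:\Omega\to\mathbb{R}$ write $S_n\phi=\sum_{i=0}^{n-1}\phi\circ T^i$. For $x,y\in\Omega$ let $W(\phi,x,y)=\sup_{n\in\mathbb{N}}\sup_{a\in A^n}|S_n\phi(ax)-S_n\phi(ay)|$, where $ax$ denotes concatenation, and for $p\in\mathbb{N}$ let $W_p(\phi)=\sup\{W(\phi,x,y): x^i=y^i,\ 0\le i\le p-1\}$. A continuous $\phi$ satisfies Walters' condition if $\sup_{x,y}W(\phi,x,y)<\infty$ and $(W_p(\phi))_{p\in\mathbb{N}}$ is a strictly positive sequence decreasing to $0$ as $p\to\infty$. Such a $\phi$ has a unique equilibrium state $\mu_\phi$, i.e. a unique shift-invariant probability measure maximizing $\nu\mapsto h(\nu)+\int\phi\,d\nu$ over shift-invariant probability measures, where $h(\nu)$ is the (Kolmogorov–Sinai) entropy. A function $K:\Omega^n\to\mathbb{R}$ is separately $d_\theta$-Lipschitz if for every $i\in\{0,\dots,n-1\}$ there is a constant $\mathrm{Lip}_{\theta,i}(K)$ (taken to be the smallest one) such that $|K(x_0,\dots,x_i,\dots,x_{n-1})-K(x_0,\dots,x_i',\dots,x_{n-1})|\le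 \mathrm{Lip}_{\theta,i}(K)\,d_\theta(x_i,x_i')$ for all points $x_0,\dots,x_{n-1},x_i'\in\Omega$. *)

(* Defs.v *)
From HB Require Import structures.
From mathcomp Require Import all_boot all_order all_algebra.
From mathcomp Require Import all_classical all_reals all_analysis.

Set Implicit Arguments.
Unset Strict Implicit.
Unset Printing Implicit Defensive.

Import Order.TTheory GRing.Theory Num.Theory.
Import numFieldNormedType.Exports.

Local Open Scope classical_set_scope.
Local Open Scope ring_scope.

(* The library's measurable types are pointed, hence so is the alphabet; no
   definition below depends on the chosen letter. *)
#[short(type="pointedFinType")]
HB.structure Definition PointedFinite := {T of Finite T & Pointed T}.

(* The product of discrete topologies is the topology of d_theta. *)
Definition Omega (A : pointedFinType) : Type :=
  prod_topology (fun _ : nat => discrete_topology A).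

HB.instance Definition _ (A : pointedFinType) := Pointed.on (Omega A).
HB.instance Definition _ (A : pointedFinType) := Topological.on (Omega A).

HB.instance Definition _ (A : pointedFinType) :=
  Measurable.copy (Omega A) (g_sigma_algebraType (@open (Omega A))).

Definition shift (A : pointedFinType) (x : Omega A) : Omega A :=
  fun k => x k.+1.

Definition dist (A : pointedFinType) (R : realType) (theta : R)
    (x y : Omega A) : R :=
  if pselect (exists k, x k != y k) is left h then theta ^+ ex_minn h else 0.

(* Past the end of a, nth returns its default value, a letter of x. *)
Definition prepend (A : pointedFinType) (a : seq A) (x : Omega A) : Omega A :=
  fun k => nth (x (k - size a)%N) a k.

Section walters.
Context (A : pointedFinType) (R : realType).
Implicit Types (phi : Omega A -> R) (x y : Omega A).

Definition birkhoff_sum phi n x : R :=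
  \sum_(0 <= i < n) phi (iter i (@shift A) x).

Definition variation phi x y : \bar R :=
  ereal_sup [set `|birkhoff_sum phi (size a) (prepend a x)
                   - birkhoff_sum phi (size a) (prepend a y)|%:E
            | a in [set: seq A]].

Definition variation_seq phi (p : nat) : \bar R :=
  ereal_sup [set variation phi xy.1 xy.2
            | xy in [set xy : Omega A * Omega A |
                     forall i, (i < p)%N -> xy.1 i = xy.2 i]].

Definition walters_condition phi : Prop :=
  [/\ (ereal_sup [set variation phi x y | x in setT & y in setT] < +oo)%E,
      (forall p, (0 < variation_seq phi p)%E),
      nonincreasing_seq (variation_seq phi) &
      variation_seq phi @ \oo --> (0 : \bar R)%E].

End walters.

Section entropy.
Context d (T : measurableType d) (R : realType).
Variables (mu : probability T R) (f : T -> T).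

(* A finite measurable partition into (possibly empty) cells is given by its
   labelling function P : T -> 'I_k. *)
Definition finite_partition k (P : T -> 'I_k) : Prop :=
  forall i, measurable (P @^-1` [set i]).

(* The cell of the join of P, f^-1 P, ..., f^-(n-1) P with itinerary w. *)
Definition join_cell k (P : T -> 'I_k) n (w : n.-tuple 'I_k) : set T :=
  [set x | forall i : 'I_n, P (iter i f x) = tnth w i].

Definition join_entropy k (P : T -> 'I_k) (n : nat) : R :=
  - \sum_(w : n.-tuple 'I_k)
      fine (mu (join_cell P w)) * ln (fine (mu (join_cell P w))).

Definition partition_entropy k (P : T -> 'I_k) : R :=
  limn (fun n => join_entropy P n / n%:R).

Definition ks_entropy : \bar R :=
  ereal_sup [set h : \bar R | exists k (P : T -> 'I_k),
    finite_partition P /\ h = (partition_entropy P)%:E].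

End entropy.

Section equilibrium.
Context (A : pointedFinType) (R : realType).
Implicit Types (phi : Omega A -> R) (mu nu : probability (Omega A) R).

Definition shift_invariant nu : Prop :=
  forall B, measurable B -> nu (@shift A @^-1` B) = nu B.

Definition free_energy phi nu : \bar R :=
  (ks_entropy nu (@shift A) + \int[nu]_x (phi x)%:E)%E.

Definition equilibrium_state phi mu : Prop :=
  shift_invariant mu /\
  forall nu, shift_invariant nu -> (free_energy phi nu <= free_energy phi mu)%E.

(* A library measure is a function on all sets, so measures are compared on
   measurable sets only. *)
Definition unique_equilibrium_state phi mu : Prop :=
  equilibrium_state phi mu /\
  forall nu, equilibrium_state phi nu ->
    forall B, measurable B -> nu B = mu B.

End equilibrium.

Section separately_lipschitz.
Context (A : pointedFinType) (R : realType) (theta : R) (n : nat).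
Implicit Types (K : ('I_n -> Omega A) -> R).

(* 0 <= L matters only for a one-letter alphabet, where dist is identically 0. *)
Definition lipschitz_constants K (i : 'I_n) : set R :=
  [set L | 0 <= L /\
    forall x y : 'I_n -> Omega A, (forall j, j != i -> x j = y j) ->
      `|K x - K y| <= L * dist theta (x i) (y i)].

Definition separately_lipschitz K : Prop :=
  forall i, lipschitz_constants K i !=set0.

Definition Lip K (i : 'I_n) : R := inf (lipschitz_constants K i).

Definition orbit_segment (x : Omega A) : 'I_n -> Omega A :=
  fun i => iter i (@shift A) x.

End separately_lipschitz.

Arguments orbit_segment {A} n x.

(* Main.v *)
Require Import Defs.
From HB Require Import structures.
From mathcomp Require Import all_boot all_order all_algebra.
From mathcomp Require Import all_classical all_reals all_analysis.
From mathcomp Require Import measurable_realfun.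
From mathcomp Require Import ring lra.
Import Defs.

Set Implicit Arguments.
Unset Strict Implicit.
Unset Printing Implicit Defensive.

Import Order.TTheory GRing.Theory Num.Theory.
Import numFieldNormedType.Exports.

Local Open Scope classical_set_scope.
Local Open Scope ring_scope.

(* Each of the four rates makes W_n summable, and nothing more is used.  An
   eigenfunction of the transfer operator (an ultrafilter limit of Cesaro means,
   so that no fixed point theorem is needed) makes phi cohomologous, up to a
   constant, to the logarithm psi of a g-function whose variations are at most
   3 W_n.  Under a coupling of two pasts the length of agreement dominates a
   house-of-cards chain, which is transient because the variations are summable;
   hence the expectation of theta^agreement is summable in time.  Writing F for
   x |-> K (x, T x, ...) and L for the transfer operator of psi, the oscillation
   osc_k of L^k F in its first letter is therefore at most the convolution of
   the Lipschitz constants of K with a summable sequence.  Iterating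
   L (exp f) <= exp (2 osc^2) exp (L f) and applying Young's inequality gives
   the bound for the functional f |-> lim L^n f.

   This functional is the integral against an invariant measure mu0, obtained
   by coding Lebesgue measure.  To see that mu0 is an equilibrium state, compare
   the law under nu of the itineraries of an arbitrary partition, by Gibbs'
   inequality, with the law of noisy itineraries of a cylindrical approximation
   of the partition weighted by psi: the entropy of nu is at most minus the
   integral of psi, with equality for mu0.  Uniqueness then gives mu = mu0. *)

(** * Topology of the sequence space *)

Section sequence_space.
Context (A : pointedFinType).
Implicit Types (x y : Omega A) (a : A).

(** The obstacle is slow decay: for polynomial rates the iterates of the operator need not contract
    exponentially. What replaces contraction is a bound on a sum over time, the total expected cost
    of disagreement [D = expR E / (1 - theta)], where [E] bounds the sum of the variations of psi
    and [expR (- E)] bounds from below the chance that a coupling of two pasts never fails. The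
    constant of the theorem is [2 * D ^+ 2]: the 2 comes from [expR y <= y + expR (2 * y ^+ 2)], the
    square of [D] from the convolution. Oscillations in the first letter suffice because one
    application of the operator averages over that letter alone. The weights of this average have
    sum 1 only for psi; as phi - psi is a constant plus a coboundary, the free energies of invariant
    measures change by that constant. *)

Definition agree m x y := forall i, (i < m)%N -> x i = y i.

Definition scons a x : Omega A := fun k => if k is k'.+1 then x k' else a.

Lemma agree_refl m x : agree m x x. Proof. by []. Qed.

Lemma agree_sym m x y : agree m x y -> agree m y x.
Proof. by move=> xy i im; rewrite xy. Qed.

Lemma agree_trans m y x z : agree m x y -> agree m y z -> agree m x z.
Proof. by move=> xy yz i im; rewrite xy// yz. Qed.

Lemma agree_le m n x y : (m <= n)%N -> agree n x y -> agree m x y.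
Proof. by move=> mn xy i im; apply: xy; exact: leq_trans mn. Qed.

Lemma agree0 x y : agree 0 x y. Proof. by []. Qed.

Lemma agree_scons m a x y : agree m x y -> agree m.+1 (scons a x) (scons a y).
Proof. by move=> xy [|i] //= im; exact: xy. Qed.

Lemma agree_shift m x y : agree m.+1 x y -> agree m (shift x) (shift y).
Proof. by move=> xy i im; exact: xy. Qed.

Lemma shift_scons a x : shift (scons a x) = x. Proof. exact/funext. Qed.

Lemma scons_shift x : scons (x 0%N) (shift x) = x.
Proof. by apply/funext => -[]. Qed.

Lemma iter_shiftE n x k : iter n (@shift A) x k = x (n + k)%N.
Proof. by elim: n x k => // n IH x k; rewrite iterS /shift IH addnS. Qed.

Lemma prepend_nil x : prepend [::] x = x.
Proof. by apply/funext => k; rewrite /prepend/= subn0 nth_nil. Qed.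

Lemma prepend_cons a s x : prepend (a :: s) x = scons a (prepend s x).
Proof. by apply/funext => -[|k]//; rewrite /prepend/=. Qed.

Lemma prepend_rcons a s x : prepend (rcons s a) x = prepend s (scons a x).
Proof.
by elim: s => [|b s IH] /=; rewrite !(prepend_cons, prepend_nil)// IH.
Qed.

Lemma agree_prepend m s x y :
  agree m x y -> agree (size s + m) (prepend s x) (prepend s y).
Proof.
move=> xy; elim: s => [|a s IH]; first by rewrite !prepend_nil.
by rewrite !prepend_cons addSn; exact: agree_scons.
Qed.

Lemma prepend_mkseq n x :
  prepend (mkseq x n) (iter n (@shift A) x) = x.
Proof.
apply/funext => k; rewrite /prepend size_mkseq; case: (ltnP k n) => kn.
  by rewrite nth_mkseq.
by rewrite nth_default ?size_mkseq// iter_shiftE subnKC.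
Qed.

Lemma agree_prepend_mkseq n x y : agree n (prepend (mkseq x n) y) x.
Proof.
by move=> i iltn; rewrite /prepend nth_mkseq.
Qed.

Lemma open_cylinder m x : open [set y | agree m x y].
Proof.
suff : open (\bigcap_(i in `I_m) [set y : Omega A | x i = y i]).
  by congr open; apply/seteqP; split => y /= xy i; exact: xy.
rewrite bigcap_mkord; elim/big_ind : _ => //; [exact: openT|exact: openI|].
move=> i _; have /continuousP cont : continuous
    (fun y : Omega A => y i : discrete_topology A).
  exact: (@proj_continuous nat (fun=> discrete_topology A) i).
by apply: (cont [set a | x i = a]); exact: discrete_open.
Qed.

(** The product topology is the supremum of the topologies pulled back by the coordinates, so the
    filter [F] generated by the cylinders around [x] converges to [x] as soon as it does so in each
    coordinate. *)
Lemma nbhs_cylinder x (U : set (Omega A)) : nbhs x U ->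
  exists m, [set y | agree m x y] `<=` U.
Proof.
pose F : set_system (Omega A) :=
  [set V | exists m, [set y | agree m x y] `<=` V].
have FF : Filter F.
  split; first by exists 0%N.
    move=> P Q [m mP] [n nQ]; exists (maxn m n) => y xy; split.
      by apply: mP; apply: agree_le xy; exact: leq_maxl.
    by apply: nQ; apply: agree_le xy; exact: leq_maxr.
  by move=> P Q PQ [m mP]; exists m => y /mP /PQ.
suff : F --> x by exact.
apply/cvg_sup => i; apply/cvg_image.
  rewrite eqEsubset; split => // a _; exists (fun=> a) => //.
move=> V xV /=.
exists [set y | V (y i)].
  exists i.+1 => y xy /=; rewrite -xy//; exact: nbhs_singleton xV.
by apply/seteqP; split => [a [y Vy <-]//|a Va]; exists (fun=> a).
Qed.

Lemma open_sub_cylinder (U : set (Omega A)) x : open U -> U x ->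
  exists m, [set y | agree m x y] `<=` U.
Proof. by move=> oU Ux; apply: nbhs_cylinder; exact: open_nbhs_nbhs. Qed.

Definition cylindrical m (C : set (Omega A)) :=
  forall x y, agree m x y -> C x -> C y.

Lemma cylindrical_open m C : cylindrical m C -> open C.
Proof.
move=> mC; rewrite openE => x Cx.
apply: (@filterS _ _ _ [set y | agree m x y]).
  by move=> y xy; exact: mC Cx.
by apply: open_nbhs_nbhs; split; [exact: open_cylinder|].
Qed.

Lemma open_measurable_Omega (C : set (Omega A)) : open C -> measurable C.
Proof. exact: sub_sigma_algebra. Qed.

Lemma cylindrical_measurable m C : cylindrical m C -> measurable C.
Proof. by move=> /cylindrical_open; exact: open_measurable_Omega. Qed.

(** The union is countable: this is how statements about Borel sets are reduced to cylinders. *)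
Lemma open_bigcup_cylindrical (U : set (Omega A)) : open U ->
  U = \bigcup_m [set x | [set y | agree m x y] `<=` U].
Proof.
move=> oU; apply/seteqP; split => [x Ux|x [m _] /(_ x)]; last exact.
by have [m mU] := open_sub_cylinder oU Ux; exists m.
Qed.

Lemma cylindrical_interior m (U : set (Omega A)) :
  cylindrical m [set x | [set y | agree m x y] `<=` U].
Proof.
by move=> x y xy /= xU z yz; apply: xU; exact: agree_trans yz.
Qed.

End sequence_space.

(** * Transfer operators *)

Section transfer_operator.
Context (A : pointedFinType) (R : realType).
Implicit Types (psi f g : Omega A -> R) (x y : Omega A).

(** Ruelle's operator: the points [scons a x] are the preimages of [x] under the shift. *)
Definition transfer psi f x : R :=
  \sum_(a : A) expR (psi (scons a x)) * f (scons a x).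

Lemma birkhoff_sum0 psi x : birkhoff_sum psi 0 x = 0.
Proof. by rewrite /birkhoff_sum big_nil. Qed.

Lemma birkhoff_sumS psi n x :
  birkhoff_sum psi n.+1 x = psi x + birkhoff_sum psi n (shift x).
Proof.
rewrite /birkhoff_sum big_nat_recl//=; congr (_ + _).
by apply: eq_bigr => i _; rewrite -iterSr.
Qed.

Lemma birkhoff_sum_scons psi n a x : birkhoff_sum psi n.+1 (scons a x) =
  psi (scons a x) + birkhoff_sum psi n x.
Proof. by rewrite birkhoff_sumS shift_scons. Qed.

Lemma le_transfer psi f g : (forall x, f x <= g x) ->
  forall x, transfer psi f x <= transfer psi g x.
Proof. by move=> fg x; apply: ler_sum => a _; rewrite ler_wpM2l// expR_ge0. Qed.

Lemma transferZ psi c f x :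
  transfer psi (fun y => c * f y) x = c * transfer psi f x.
Proof. by rewrite /transfer mulr_sumr; apply: eq_bigr => a _;
  rewrite mulrCA. Qed.

Lemma transfer_sum psi (I : Type) (r : seq I) (P : pred I)
    (F : I -> Omega A -> R) x :
  transfer psi (fun y => \sum_(i <- r | P i) F i y) x =
  \sum_(i <- r | P i) transfer psi (F i) x.
Proof.
rewrite exchange_big /=; apply: eq_bigr => a _; exact: mulr_sumr.
Qed.

Lemma transfer_shift psi f g x :
  transfer psi (fun y => f (shift y) * g y) x = f x * transfer psi g x.
Proof.
rewrite /transfer mulr_sumr; apply: eq_bigr => a _.
by rewrite shift_scons mulrCA.
Qed.

Lemma eq_transfer psi f g : f =1 g -> transfer psi f =1 transfer psi g.
Proof. by move=> /funext->. Qed.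

Lemma le_iter_transfer psi n f g : (forall x, f x <= g x) ->
  forall x, iter n (transfer psi) f x <= iter n (transfer psi) g x.
Proof. by elim: n => // n IH fg x /=; apply: le_transfer => y; exact: IH. Qed.

Lemma iter_transferZ psi n c f x :
  iter n (transfer psi) (fun y => c * f y) x = c * iter n (transfer psi) f x.
Proof.
elim: n x => // n IH x /=; rewrite -transferZ; exact: eq_transfer.
Qed.

Lemma iter_transfer_sum psi n (I : Type) (r : seq I) (P : pred I)
    (F : I -> Omega A -> R) x :
  iter n (transfer psi) (fun y => \sum_(i <- r | P i) F i y) x =
  \sum_(i <- r | P i) iter n (transfer psi) (F i) x.
Proof.
elim: n x => // n IH x /=; rewrite -transfer_sum; exact: eq_transfer.
Qed.

Lemma transferD psi f g x : transfer psi (fun y => f y + g y) x =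
  transfer psi f x + transfer psi g x.
Proof. by rewrite -big_split; apply: eq_bigr => a _; rewrite mulrDr. Qed.

Lemma iter_transferD psi n f g x : iter n (transfer psi) (fun y =>
  f y + g y) x =
  iter n (transfer psi) f x + iter n (transfer psi) g x.
Proof.
elim: n x => // n IH x /=; rewrite -transferD; exact: eq_transfer.
Qed.

Definition cylinder (s : seq A) : set (Omega A) :=
  [set x | mkseq x (size s) = s].

Lemma mkseqSl (x : Omega A) n : mkseq x n.+1 = x 0%N :: mkseq (shift x) n.
Proof.
rewrite /mkseq /=; congr (_ :: _).
by rewrite -[1%N]/(1 + 0)%N iotaDl -map_comp.
Qed.

Lemma agree_mkseq n x y : agree n x y <-> mkseq x n = mkseq y n.
Proof.
split => [xy|xy i iltn].
  by apply/eq_in_map => i; rewrite mem_iota => /andP[_]; exact: xy.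
by have := congr1 (fun s => nth (x 0%N) s i) xy; rewrite !nth_mkseq.
Qed.

Lemma cylindrical_cylinder s : cylindrical (size s) (cylinder s).
Proof. by move=> x y /agree_mkseq xy; rewrite /cylinder/= xy. Qed.

Lemma cylinder_cons a s b x :
  \1_(cylinder (a :: s)) (scons b x) = (a == b)%:R * \1_(cylinder s) x :> R.
Proof.
rewrite !indicE -natrM mulnb; congr (_%:R); congr nat_of_bool.
apply/idP/idP.
  rewrite inE /cylinder /= -/(_.+1) mkseqSl => -[-> bs].
  by rewrite eqxx /=; rewrite inE /=; rewrite shift_scons in bs.
move=> /andP[/eqP -> ]; rewrite !inE /cylinder/= -/(_.+1) mkseqSl.
by rewrite shift_scons => ->.
Qed.

(** Of all branches of the iterate, only the one that prepends [s] ends in the cylinder. *)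
Lemma iter_transfer_cylinder psi s f y :
  iter (size s) (transfer psi) (fun x => \1_(cylinder s) x * f x) y =
  expR (birkhoff_sum psi (size s) (prepend s y)) * f (prepend s y).
Proof.
elim: s f => [|a s IH] f.
  by rewrite /= birkhoff_sum0 expR0 prepend_nil indicE mem_set.
rewrite prepend_cons [size _]/= birkhoff_sum_scons addrC expRD -mulrA.
rewrite -(IH (fun x => expR (psi (scons a x)) * f (scons a x))) iterSr.
congr (iter _ _ _ _); apply/funext => x; rewrite /transfer (bigD1 a)//= big1.
  by rewrite addr0 cylinder_cons eqxx mul1r mulrCA.
by move=> b ba; rewrite cylinder_cons eq_sym (negbTE ba) !mul0r mulr0.
Qed.

Lemma transfer_ge_branch psi s f y : (forall x, 0 <= f x) ->
  expR (birkhoff_sum psi (size s) (prepend s y)) * f (prepend s y) <=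
  iter (size s) (transfer psi) f y.
Proof.
move=> f0; rewrite -iter_transfer_cylinder; apply: le_iter_transfer => x.
by rewrite ler_piMl// indicE lern1 leq_b1.
Qed.

End transfer_operator.

(** * Markov operators of g-functions and their one-step couplings *)

Section normalized_transfer.
Context (A : pointedFinType) (R : realType) (psi : Omega A -> R).
Implicit Types (f g : Omega A -> R) (x y : Omega A).

Hypothesis psi1 : forall x, \sum_(a : A) expR (psi (scons a x)) = 1.

Lemma transfer_cst c x : transfer psi (fun=> c) x = c.
Proof. by rewrite /transfer -mulr_suml psi1 mul1r. Qed.

Lemma iter_transfer_cst n c x : iter n (transfer psi) (fun=> c) x = c.
Proof.
elim: n x => //= n IH x; rewrite -[RHS](transfer_cst c x).
exact: eq_transfer.
Qed.

Lemma iter_transfer_le n f c x :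
  (forall y, f y <= c) -> iter n (transfer psi) f x <= c.
Proof.
move=> fc; rewrite -[leRHS](iter_transfer_cst n c x).
exact: le_iter_transfer.
Qed.

Lemma iter_transfer_ge n f c x :
  (forall y, c <= f y) -> c <= iter n (transfer psi) f x.
Proof.
move=> fc; rewrite -[leLHS](iter_transfer_cst n c x).
exact: le_iter_transfer.
Qed.

Lemma transfer_comp_shift f x : transfer psi (fun y => f (shift y)) x = f x.
Proof.
rewrite -[RHS]mulr1 -(transfer_cst 1 x) -transfer_shift.
by apply: eq_transfer => y; rewrite mulr1.
Qed.

(* The mass common to the two transition probabilities is transported along
   equal letters, the rest arbitrarily. *)
Let coupling1 f x y c e0 e1 q : 0 <= q -> q <= 1 -> e1 <= e0 ->
  (forall a, q * expR (psi (scons a x)) <= expR (psi (scons a y))) ->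
  (forall a, f (scons a x) - f (scons a y) <= c + e1) ->
  (forall a b, f (scons a x) - f (scons b y) <= c + e0) ->
  transfer psi f x - transfer psi f y <= c + (q * e1 + (1 - q) * e0).
Proof.
move=> q0 q1 e10 qxy f1 f0.
pose p a := expR (psi (scons a x)); pose p' a := expR (psi (scons a y)).
pose k a := Num.min (p a) (p' a).
have kp a : k a <= p a by rewrite /k ge_min lexx.
have kp' a : k a <= p' a by rewrite /k ge_min lexx orbT.
have k0 a : 0 <= k a by rewrite /k le_min !expR_ge0.
have qk a : q * p a <= k a.
  by rewrite /k le_min qxy andbT ler_piMl// expR_ge0.
pose s := \sum_a k a.
have qs : q <= s.
  rewrite -[leLHS]mulr1 -(psi1 x) mulr_sumr; apply: ler_sum => a _; exact: qk.
have sp : \sum_a (p a - k a) = 1 - s by rewrite sumrB psi1.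
have sp' : \sum_a (p' a - k a) = 1 - s by rewrite sumrB psi1.
(* The masses left over at [x] and at [y] are equal, so transporting one to the other costs at most
   the largest value over [x] minus the smallest over [y]. *)
pose a0 := [arg max_(a > (point : A)) f (scons a x)]%O.
pose b0 := [arg min_(a < (point : A)) f (scons a y)]%O.
have Ha a : f (scons a x) <= f (scons a0 x).
  by rewrite /a0; case: arg_maxP => // i _ /(_ a); exact.
have Hb a : f (scons b0 y) <= f (scons a y).
  by rewrite /b0; case: arg_minP => // i _ /(_ a); exact.
have -> : transfer psi f x - transfer psi f y =
    \sum_a k a * (f (scons a x) - f (scons a y)) +
    (\sum_a (p a - k a) * f (scons a x) - \sum_a (p' a - k a) * f (scons a y)).
  rewrite /transfer -!sumrB -big_split /=; apply: eq_bigr => a _.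
  rewrite -/(p a) -/(p' a); ring.
have h1 : \sum_a k a * (f (scons a x) - f (scons a y)) <= s * (c + e1).
  by rewrite mulr_suml; apply: ler_sum => a _; rewrite ler_wpM2l.
have h2 : \sum_a (p a - k a) * f (scons a x) <= (1 - s) * f (scons a0 x).
  by rewrite -sp mulr_suml; apply: ler_sum => a _; rewrite ler_wpM2l// subr_ge0.
have h3 : (1 - s) * f (scons b0 y) <= \sum_a (p' a - k a) * f (scons a y).
  by rewrite -sp' mulr_suml; apply: ler_sum => a _;
    rewrite ler_wpM2l// subr_ge0.
have s1 : 0 <= 1 - s by rewrite -sp sumr_ge0// => a _; rewrite subr_ge0.
have h4 : (1 - s) * (f (scons a0 x) - f (scons b0 y)) <= (1 - s) * (c + e0).
  by rewrite ler_wpM2l.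
(* At least mass [q] moves along equal letters; as [e1 <= e0], a larger mass only lowers the
   cost. *)
have h5 : 0 <= (s - q) * (e0 - e1) by rewrite mulr_ge0 ?subr_ge0.
nra.
Qed.

(** The weights of equal letters differ by a factor of at most [expR eta], so equal letters can be
    chosen with chance at least [expR (- eta)]; [c] is the part of the cost that does not depend on
    the outcome. *)
Lemma transfer_coupling f x y c e0 e1 eta : 0 <= eta -> e1 <= e0 ->
  (forall a, `|psi (scons a x) - psi (scons a y)| <= eta) ->
  (forall a, `|f (scons a x) - f (scons a y)| <= c + e1) ->
  (forall a b, `|f (scons a x) - f (scons b y)| <= c + e0) ->
  `|transfer psi f x - transfer psi f y| <=
    c + (expR (- eta) * e1 + (1 - expR (- eta)) * e0).
Proof.
move=> eta0 e10 psixy f1 f0.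
have q1 : expR (- eta) <= 1 by rewrite -expR0 ler_expR oppr_le0.
rewrite ler_norml lerNl opprB; apply/andP; split.
  apply: coupling1 => //.
  - move=> a; rewrite -expRD ler_expR; have := psixy a.
    by rewrite ler_norml => /andP[]; lra.
  - by move=> a; have := f1 a; rewrite ler_norml => /andP[]; lra.
  - by move=> a b; have := f0 b a; rewrite ler_norml => /andP[]; lra.
apply: coupling1 => //.
- move=> a; rewrite -expRD ler_expR; have := psixy a.
  by rewrite ler_norml => /andP[]; lra.
- by move=> a; have := f1 a; rewrite ler_norml => /andP[].
- by move=> a b; have := f0 a b; rewrite ler_norml => /andP[].
Qed.

End normalized_transfer.

(** * House-of-cards chains *)

Section house_of_cards.
Context (R : realType) (eta : nat -> R).
Hypothesis eta_ge0 : forall m, 0 <= eta m.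
Implicit Types (e V : nat -> R).

(* Transition operator of the chain that moves from m to m + 1 with probability
   exp (- eta m) and falls to 0 otherwise. *)
Definition house e m : R :=
  expR (- eta m) * e m.+1 + (1 - expR (- eta m)) * e 0%N.

Let q_le1 m : 0 <= 1 - expR (- eta m).
Proof. by rewrite subr_ge0 -expR0 ler_expR oppr_le0. Qed.

Lemma le_house e V : (forall m, e m <= V m) -> forall m, house e m <= house V m.
Proof. by move=> eV m; rewrite lerD// ler_wpM2l// expR_ge0. Qed.

Lemma house_ge0 e : (forall m, 0 <= e m) -> forall m, 0 <= house e m.
Proof. by move=> e0 m; rewrite addr_ge0// mulr_ge0// expR_ge0. Qed.

Lemma iter_house_ge0 k e : (forall m, 0 <= e m) ->
  forall m, 0 <= iter k house e m.
Proof. by move=> e0; elim: k => //= k; exact: house_ge0. Qed.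

Lemma house_sum (I : Type) (r : seq I) (P : pred I) (F : I -> nat -> R) m :
  house (fun j => \sum_(i <- r | P i) F i j) m = \sum_(i <- r | P i) house (F
    i) m.
Proof. by rewrite /house big_split /= -!mulr_sumr. Qed.

Lemma houseZ c e m : house (fun j => c * e j) m = c * house e m.
Proof. rewrite /house; ring. Qed.

Lemma iter_house_affine k c b e m :
  iter k house (fun j => c + b * e j) m = c + b * iter k house e m.
Proof.
elim: k m => // k IH m /=; rewrite /house !IH; ring.
Qed.

(** The minimum principle of potential theory: a nonnegative solution [V] of [e + house V <= V]
    dominates the Green potential of [e]. *)
Lemma sum_iter_house_le e V : (forall m, 0 <= V m) ->
  (forall m, e m + house V m <= V m) ->
  forall N m, \sum_(k < N) iter k house e m <= V m.
Proof.
move=> V0 eV; elim=> [|N IH] m; first by rewrite big_ord0.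
rewrite big_ord_recl /= (le_trans _ (eV m))// lerD2l.
rewrite (eq_bigr (fun i : 'I_N => house (iter i house e) m)) => [|i _//].
by rewrite -house_sum; exact: le_house.
Qed.

Section monotone.
Hypothesis eta_nincr : forall m, eta m.+1 <= eta m.

(** From a longer agreement the chance of a further extension is larger, so the chain is
    stochastically monotone. The coupling needs this: extending the agreement must not cost more
    than losing it. *)
Lemma house_nonincreasing e : (forall m, e m.+1 <= e m) ->
  forall m, house e m.+1 <= house e m.
Proof.
move=> ee m; rewrite /house.
have e0 : e m.+2 <= e 0%N.
  by elim: m.+2 => // n; apply: le_trans.
have q : expR (- eta m) <= expR (- eta m.+1) by rewrite ler_expR lerN2.
have h1 : 0 <= (expR (- eta m.+1) - expR (- eta m)) * (e 0%N - e m.+2).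
  by rewrite mulr_ge0// subr_ge0.
have h2 : 0 <= expR (- eta m) * (e m.+1 - e m.+2).
  by rewrite mulr_ge0 ?expR_ge0// subr_ge0.
nra.
Qed.

Lemma iter_house_nonincreasing k e : (forall m, e m.+1 <= e m) ->
  forall m, iter k house e m.+1 <= iter k house e m.
Proof. by move=> ee; elim: k => //= k; exact: house_nonincreasing. Qed.

End monotone.

Section summable.
Context (E theta : R).
Hypotheses (sum_eta : forall N, \sum_(k < N) eta k <= E).
Hypotheses (theta_gt0 : 0 < theta) (theta_lt1 : theta < 1).

(** Each excursion from 0 costs at most the geometric sum [(1 - theta)^-1]; the chain started at 0
    escapes with chance at least [expR (- E)], so the expected number of excursions is at most
    [expR E]. *)
Definition house_bound : R := (1 - theta)^-1 * expR E.

(* exp (- (E - eta_0 - ... - eta_(m-1))) bounds from below the probability of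
   never falling from m, whence a superharmonic function. *)
Lemma sum_iter_house_exp N :
  \sum_(k < N) iter k house (fun m => theta ^+ m) 0 <= house_bound.
Proof.
pose p m := expR (- (E - \sum_(k < m) eta k)).
have pS m : p m = expR (- eta m) * p m.+1.
  rewrite /p -expRD big_ord_recr /=; congr expR; ring.
have p1 m : p m <= 1 by rewrite /p -expR0 ler_expR oppr_le0 subr_ge0.
have p0E : p 0%N = expR (- E) by rewrite /p big_ord0 subr0.
have t0 : 0 < (1 - theta)^-1 by rewrite invr_gt0 subr_gt0.
(* The first term pays for the run up to the next fall, the second for a restart at 0, [1 - p m]
   being an upper bound for the chance of a fall. *)
pose V m := (1 - theta)^-1 * theta ^+ m + house_bound * (1 - p m).
have V0 m : 0 <= V m.
  rewrite addr_ge0// mulr_ge0 ?subr_ge0//; first exact: ltW.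
    by rewrite exprn_ge0// ltW.
  by rewrite mulr_ge0 ?expR_ge0// ltW.
have Bp : house_bound * p 0%N = (1 - theta)^-1.
  by rewrite /house_bound p0E -mulrA -expRD subrr expR0 mulr1.
have VE : V 0%N = house_bound by rewrite /V expr0; lra.
rewrite -VE; apply: sum_iter_house_le => // m.
have q := q_le1 m; have := pS m; rewrite /house.
rewrite /V. rewrite expr0 exprS; set Q := expR (- eta m) in q * => ->.
set B := house_bound in Bp *.
have tm : 0 <= theta ^+ m by rewrite exprn_ge0// ltW.
have e1 : theta ^+ m = (1 - theta)^-1 * theta ^+ m * (1 - theta).
  by rewrite mulrAC mulVf ?mul1r// subr_eq0 gt_eqF.
set u := (1 - theta)^-1 in t0 Bp e1 *; set tt := theta ^+ m in tm e1 *.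
(* This quantity is exactly the difference of the two sides. *)
have h : 0 <= (1 - Q) * (u * tt * theta).
  by rewrite mulr_ge0// !mulr_ge0// ltW.
nra.
Qed.

Lemma iter_house_exp_cvg0 : iter n house (fun m =>
  theta ^+ m) 0 @[n --> \oo] --> 0.
Proof.
apply: cvg_series_cvg_0; apply: nondecreasing_is_cvgn.
  apply: nondecreasing_series => n _ _; apply: iter_house_ge0 => m.
  by rewrite exprn_ge0// ltW.
exists house_bound => _ [n _ <-]; rewrite /series /= big_mkord.
exact: sum_iter_house_exp.
Qed.

End summable.

End house_of_cards.

(** * Eigenfunction of the transfer operator *)

Lemma ln_homo (R : realType) (a b : R) : 0 < a -> a <= b -> ln a <= ln b.
Proof. by move=> a0 ab; rewrite ler_ln// posrE (lt_le_trans a0). Qed.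

(** Comparing [l (n * m)] with multiples of [l n] and of [l m] shows that for positive indices every
    [(l n - D) / n] lies below every [(l m + D) / m]; [P] is the supremum of the former. *)
Lemma almost_additive_linear (R : realType) (l : nat -> R) (D : R) :
  (forall n m, `|l (n + m)%N - l n - l m| <= D) ->
  exists P : R, forall n, `|l n - n%:R * P| <= D.
Proof.
move=> lD.
have D0 : 0 <= D by apply: le_trans (lD 0 0)%N.
have lM n m : `|l (n.+1 * m)%N - n.+1%:R * l m| <= n%:R * D.
  elim: n => [|n IH]; first by rewrite mul1n mul1r subrr normr0 mul0r.
  have := lD (n.+1 * m)%N m; rewrite -mulSnr => h.
  have E2 : n.+2%:R = n.+1%:R + 1 :> R by rewrite natr1.
  have E1 : n.+1%:R * D = n%:R * D + D by rewrite -natr1 mulrDl mul1r.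
  move: IH h; rewrite !ler_norml E2 E1 mulrDl mul1r.
  by move=> /andP[? ?] /andP[? ?]; apply/andP; split; lra.
pose S := [set (l n.+1 - D) / n.+1%:R | n in [set: nat]].
have key n m : (l n.+1 - D) / n.+1%:R <= (l m.+1 + D) / m.+1%:R.
  rewrite ler_pdivrMr ?ltr0n// mulrAC ler_pdivlMr ?ltr0n//.
  have := lM m n.+1; have := lM n m.+1; rewrite mulnC.
  rewrite !ler_norml => /andP[_ h1] /andP[h2 _].
  move: h1 h2; rewrite -![_.+1%:R]natr1 => h1 h2; nra.
have Sub m : ubound S ((l m.+1 + D) / m.+1%:R) by move=> _ [n _ <-].
have S0 : S !=set0 by exists ((l 1%N - D) / 1%:R); exists 0%N.
exists (sup S) => -[|n].
  have := lD 0%N 0%N; rewrite mul0r subr0 addn0.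
  by rewrite subrr sub0r normrN.
have h1 : (l n.+1 - D) / n.+1%:R <= sup S.
  by apply: ub_le_sup; [exists ((l 1%N + D) / 1%:R); exact: Sub | exists n].
have h2 : sup S <= (l n.+1 + D) / n.+1%:R by apply: ge_sup.
move: h1 h2; rewrite ler_pdivrMr ?ltr0n// ler_pdivlMr ?ltr0n// mulrC => h1 h2.
by rewrite ler_norml; apply/andP; split; lra.
Qed.

(** Compactness gives a cluster point, and an ultrafilter converges to each of its cluster
    points. *)
Lemma bounded_ultrafilter_cvg (R : realType) (U : set_system nat)
    (UU : UltraFilter U) (u : nat -> R) (a b : R) :
  (forall n, a <= u n <= b) -> exists l : R, u @ U --> l.
Proof.
move=> uab; have Uab : fmap u U `[a, b]%classic.
  by apply: (@filterE _ U) => n; rewrite /= in_itv/= uab.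
have [l [_ ul]] := @segment_compact R a b (fmap u U) _ Uab.
exists l => V lV.
have [//|UV] := in_ultra_setVsetC (u @^-1` V) UU.
by have [r []] := ul _ _ (UV : fmap u U (~` V)) lV.
Qed.

Section ruelle_perron_frobenius.
Context (A : pointedFinType) (R : realType) (phi : Omega A -> R) (w : nat -> R).
Implicit Types (f : Omega A -> R) (x y : Omega A) (s : seq A).

Hypothesis phi_distortion : forall s x y m, agree m x y ->
  `|birkhoff_sum phi (size s) (prepend s x)
    - birkhoff_sum phi (size s) (prepend s y)| <= w m.

Lemma birkhoff_sum_rcons s a x :
  birkhoff_sum phi (size (rcons s a)) (prepend (rcons s a) x) =
  birkhoff_sum phi (size s) (prepend s (scons a x)) + phi (scons a x).
Proof.
elim: s => [|b s IH].
  by rewrite /= prepend_cons !prepend_nil birkhoff_sum_scons !birkhoff_sum0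
    addrC.
rewrite [rcons _ _]/= [size _]/= prepend_cons birkhoff_sum_scons IH.
by rewrite prepend_cons birkhoff_sum_scons prepend_rcons addrA.
Qed.

(* Unlike [variation], without absolute value: this makes the class [cone]
   below exactly invariant under the transfer operator. *)
Let V x y : R := sup [set birkhoff_sum phi (size s) (prepend s x)
    - birkhoff_sum phi (size s) (prepend s y) | s in [set: seq A]].

Let V_le m x y : agree m x y -> V x y <= w m.
Proof.
move=> xy; apply: ge_sup; first by eexists; exists [::].
by move=> _ [s _ <-]; apply: le_trans (phi_distortion s xy); exact: ler_norm.
Qed.

Let V_ub s x y : birkhoff_sum phi (size s) (prepend s x)
    - birkhoff_sum phi (size s) (prepend s y) <= V x y.
Proof.
apply: ub_le_sup; last by exists s.
exists (w 0%N) => _ [r _ <-]; apply: le_trans (phi_distortion r (@agree0 _ x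
  y)).
exact: ler_norm.
Qed.

(** Words in front of [scons a x] are the words ending in [a] in front of [x], so up to the values
    of [phi] the left supremum runs over part of the words of the right one. *)
Let V_scons a x y :
  phi (scons a x) + V (scons a x) (scons a y) <= phi (scons a y) + V x y.
Proof.
suff : V (scons a x) (scons a y) <= phi (scons a y) - phi (scons a x) + V x y.
  lra.
apply: ge_sup; first by eexists; exists [::].
move=> _ [s _ <-]; have := V_ub (rcons s a) x y; rewrite !birkhoff_sum_rcons.
lra.
Qed.

(** For positive [f], the logarithm has increments at most [V]. The condition is stable under
    positive combinations and pointwise limits, hence is inherited by the eigenfunction. *)
Let cone f := (forall x, 0 <= f x) /\ forall x y, f x <= expR (V x y) * f y.

Let cone_transfer f : cone f -> cone (transfer phi f).
Proof.
move=> [f0 fV]; split => [x|x y].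
  by rewrite sumr_ge0// => a _; rewrite mulr_ge0// expR_ge0.
rewrite /transfer mulr_sumr; apply: ler_sum => a _.
apply: le_trans (ler_wpM2l (expR_ge0 _) (fV _ (scons a y))) _.
rewrite !mulrA -!expRD ler_wpM2r// ler_expR addrC [V x y + _]addrC.
rewrite [V (scons _ _) _ + _]addrC; exact: V_scons.
Qed.

Let L n := iter n (transfer phi) (fun=> 1).

Let cone_L n : cone (L n).
Proof.
elim: n => [|n]; last exact: cone_transfer.
split => [x|x y] /=; first exact: ler01.
by rewrite mulr1 -expR0 ler_expR; have := V_ub [::] x y;
  rewrite !birkhoff_sum0 subrr.
Qed.

Let D := w 0%N.

Let VD x y : V x y <= D. Proof. exact: V_le. Qed.

Let L_le n x y : L n x <= expR D * L n y.
Proof.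
have [L0 /(_ x y) h] := cone_L n; apply: le_trans h _.
by rewrite ler_wpM2r// ler_expR.
Qed.

Let L_gt0 n x : 0 < L n x.
Proof.
elim: n x => [|n IH] x; first exact: ltr01.
rewrite [L _ _]/(transfer phi (L n) x) /transfer (bigD1 point)//=.
rewrite ltr_wpDr ?mulr_gt0 ?expR_gt0// sumr_ge0// => a _.
by rewrite mulr_ge0 ?expR_ge0// ltW.
Qed.

(** [L (n + m)] is the [n]-th iterate applied to [L m], which is constant up to the factor
    [expR D]. *)
Let LD n m x y : `|ln (L (n + m) x) - ln (L n x) - ln (L m y)| <= D.
Proof.
have hL c n' z : iter n' (transfer phi) (fun=> c) z = c * L n' z.
  by rewrite -iter_transferZ; congr (iter _ _ _ _); apply/funext => u;
    rewrite mulr1.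
have e1 : L (n + m) x <= (expR D * L m y) * L n x.
  rewrite /L iterD -hL; apply: le_iter_transfer => z; exact: L_le.
have e2 : (expR (- D) * L m y) * L n x <= L (n + m) x.
  rewrite /L iterD -hL; apply: le_iter_transfer => z.
  rewrite expRN mulrC ler_pdivrMr ?expR_gt0// mulrC; exact: L_le.
have := ln_homo (L_gt0 _ _) e1; have := ln_homo _ e2.
rewrite !mulr_gt0 ?expR_gt0// => /(_ isT).
rewrite !lnM ?posrE ?mulr_gt0 ?expR_gt0// !expRK => h1 h2.
by rewrite ler_norml; apply/andP; split; lra.
Qed.

(** [P] is the exponential growth rate of [L n], the pressure, and [expR H] is an eigenfunction for
    the eigenvalue [expR P]. *)
Lemma pressure_eigenfunction : exists (P : R) (H : Omega A -> R),
  [/\ forall x, `|H x| <= 2 * D,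
      forall m x y, agree m x y -> `|H x - H y| <= w m &
      forall x, \sum_(a : A) expR (phi (scons a x) - P + H (scons a x) - H x) =
        1].
Proof.
pose x0 : Omega A := point.
have [P LP] := @almost_additive_linear R (fun n => ln (L n x0)) D
  (fun n m => LD n m x0 x0).
pose f k x := expR (- (k%:R * P)) * L k x.
have fb k x : expR (- (2 * D)) <= f k x <= expR (2 * D).
  have := LP k; rewrite ler_norml => /andP[].
  have := ln_homo (L_gt0 _ _) (L_le k x x0).
  have := ln_homo (L_gt0 _ _) (L_le k x0 x).
  rewrite !lnM ?posrE ?expR_gt0// !expRK => h1 h2 h3 h4.
  rewrite /f -[L k x]lnK ?posrE// -expRD !ler_expR; apply/andP; split; lra.
have fS k x : transfer phi (f k) x = expR P * f k.+1 x.
  rewrite transferZ /f mulrA -expRD /=; congr (expR _ * _).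
  rewrite -natr1; ring.
have fcone k x y : f k x <= expR (V x y) * f k y.
  by rewrite /f mulrCA ler_wpM2l ?expR_ge0//; case: (cone_L k).
pose h n x := n.+1%:R^-1 * \sum_(k < n.+1) f k x.
have sum1 n (c : R) : \sum_(k < n.+1) c = c * n.+1%:R.
  by rewrite sumr_const card_ord mulr_natr.
have hb x n : expR (- (2 * D)) <= h n x <= expR (2 * D).
  rewrite /h [_^-1 * _]mulrC ler_pdivlMr ?ltr0n// ler_pdivrMr ?ltr0n//.
  by apply/andP; split; rewrite -sum1; apply: ler_sum => k _;
    case/andP: (fb k x).
have hcone n x y : h n x <= expR (V x y) * h n y.
  rewrite /h mulrCA ler_wpM2l ?invr_ge0 ?ler0n// mulr_sumr.
  by apply: ler_sum => k _.
(* The sum telescopes: up to the factor [expR P] the mean is invariant except for two bounded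
   boundary terms divided by [n + 1]. *)
have hS n x : transfer phi (h n) x =
    expR P * (h n x + n.+1%:R^-1 * (f n.+1 x - f 0%N x)).
  rewrite transferZ transfer_sum mulrDr /h -!mulrDr mulrCA; congr (_ * _).
  rewrite (eq_bigr (fun k : 'I_n.+1 => expR P * f k.+1 x)) => [|k _];
    last exact: fS.
  rewrite -mulr_sumr; congr (_ * _).
  by rewrite [in RHS]big_ord_recl /= big_ord_recr /=; ring.
have [U [UU sU]] := @ultraFilterLemma nat \oo _.
have hcvg x : exists l : R, h n x @[n --> U] --> l.
  exact: (bounded_ultrafilter_cvg UU (hb x)).
have [h_ h_cvg] : {h_ : Omega A -> R | forall x, h n x @[n --> U] --> h_ x}.
  by exists (fun x => sval (cid (hcvg x))) => x; case: cid.
have FU : ProperFilter U := @ultra_proper _ _ UU.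
have h_b x : expR (- (2 * D)) <= h_ x <= expR (2 * D).
  apply/andP; split.
    apply: (cvgr_to_ge (h_cvg x)).
    by apply: filterE => n; have /andP[] := hb x n.
  apply: (cvgr_to_le (h_cvg x)).
  by apply: filterE => n; have /andP[] := hb x n.
have h_gt0 x : 0 < h_ x by have /andP[+ _] := h_b x; apply: lt_le_trans;
  exact: expR_gt0.
have h_cone x y : h_ x <= expR (V x y) * h_ y.
  rewrite -subr_ge0.
  have : expR (V x y) * h n y - h n x @[n --> U] --> expR (V x y) * h_ y - h_ x.
    by apply: cvgB => //; apply: cvgMl_tmp.
  move/cvgr_to_ge; apply.
  by apply: filterE => n /=; rewrite subr_ge0.
have h_S x : transfer phi h_ x = expR P * h_ x.
  have c1 : transfer phi (h n) x @[n --> U] --> transfer phi h_ x.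
    rewrite /transfer; apply: cvg_big => [|a _]; first exact: add_continuous.
    exact: cvgMl_tmp.
  have c2 : transfer phi (h n) x @[n --> U] --> expR P * (h_ x + 0).
    under eq_fun do rewrite hS.
    apply: cvgMl_tmp; apply: cvgD => //.
    apply: cvg_trans (cvg_app _ sU) _.
    apply: (@squeeze_cvgr _ _ _ _ (fun n => - (expR (2 * D) * n.+1%:R^-1))
      (fun n => expR (2 * D) * n.+1%:R^-1)).
    - apply: filterE => n.
      have n0 : 0 <= (n.+1%:R : R)^-1 by rewrite invr_ge0.
      have /andP[a1 a2] := fb n.+1 x; have /andP[b1 b2] := fb 0%N x.
      have e0 := expR_gt0 (- (2 * D)).
      by rewrite [_^-1 * _]mulrC -mulNr !ler_wpM2r//; lra.
    - rewrite -oppr0 -[X in - X](mulr0 (expR (2 * D))).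
      by apply: cvgN; apply: cvgMl_tmp; exact: cvg_harmonic.
    - rewrite -[X in _ --> X](mulr0 (expR (2 * D))).
      by apply: cvgMl_tmp; exact: cvg_harmonic.
  by rewrite addr0 in c2; exact: (cvg_unique _ c1 c2).
exists P, (fun x => ln (h_ x)); split.
- move=> x; have /andP[h1 h2] := h_b x.
  have := ln_homo (expR_gt0 _) h1; have := ln_homo (h_gt0 x) h2.
  by rewrite !expRK => ? ?; rewrite ler_norml; apply/andP; split; lra.
- have lnV x y : ln (h_ x) - ln (h_ y) <= V x y.
    have := ln_homo (h_gt0 x) (h_cone x y);
      by rewrite lnM ?posrE ?expR_gt0// expRK; lra.
  move=> m x y xy; have := lnV x y; have := lnV y x.
  have := V_le xy; have := V_le (agree_sym xy).
  by rewrite ler_norml => *; apply/andP; split; lra.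
- move=> x; rewrite (eq_bigr (fun a => (expR P * h_ x)^-1 *
    (expR (phi (scons a x)) * h_ (scons a x)))) => [|a _].
    by rewrite -mulr_sumr -/(transfer phi h_ x) h_S mulVf// gt_eqF// mulr_gt0
      ?expR_gt0.
  rewrite !expRD !expRN !lnK ?posrE// invfM; ring.
Qed.

End ruelle_perron_frobenius.

(** * The limit functional of a g-function *)

Section uniformly_continuous.
Context (A : pointedFinType) (R : realType).
Implicit Types (f g : Omega A -> R) (x y : Omega A).

(** Uniform continuity for [d_theta], stated without a metric; by compactness it amounts to
    continuity. *)
Definition ucont f := forall eps, 0 < eps ->
  exists m, forall x y, agree m x y -> `|f x - f y| <= eps.

Lemma cylindrical_ucont m f :
  (forall x y, agree m x y -> f x = f y) -> ucont f.
Proof. by move=> fm e e0; exists m => x y /fm ->; rewrite subrr normr0 ltW. Qed.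

Lemma ucont_cst c : ucont (fun=> c).
Proof. exact: (@cylindrical_ucont 0). Qed.

Lemma ucont_indic m (C : set (Omega A)) : cylindrical m C -> ucont (\1_C).
Proof.
move=> mC; apply: (@cylindrical_ucont m) => x y xy; rewrite !indicE.
congr (_%:R); congr nat_of_bool; apply/idP/idP; rewrite !inE; apply: mC => //.
exact: agree_sym.
Qed.

Lemma ucontD f g : ucont f -> ucont g -> ucont (fun x => f x + g x).
Proof.
move=> uf ug e e0; have e2 : 0 < e / 2 by rewrite divr_gt0.
have [m fm] := uf _ e2; have [n gn] := ug _ e2.
exists (maxn m n) => x y xy.
have := fm x y (agree_le (leq_maxl m n) xy).
have := gn x y (agree_le (leq_maxr m n) xy).
rewrite !ler_norml => /andP[? ?] /andP[? ?]; apply/andP; split; lra.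
Qed.

Lemma ucontZ c f : ucont f -> ucont (fun x => c * f x).
Proof.
move=> uf e e0; have c0 : 0 < `|c| + 1 by rewrite ltr_wpDl.
have [m fm] := uf (e / (`|c| + 1)) (divr_gt0 e0 c0).
exists m => x y /fm; rewrite -mulrBr normrM ler_pdivlMr//.
have := normr_ge0 (f x - f y); have := normr_ge0 c; nra.
Qed.

Lemma ucont_sum (I : Type) (r : seq I) (P : pred I) (F : I -> Omega A -> R) :
  (forall i, ucont (F i)) -> ucont (fun x => \sum_(i <- r | P i) F i x).
Proof.
move=> uF; elim: r => [|i r IH].
  rewrite (_ : (fun _ => _) = fun=> 0); first exact: ucont_cst.
  by apply/funext => x; rewrite big_nil.
case Pi : (P i).
  rewrite (_ : (fun _ => _) = fun x => F i x + \sum_(j <- r | P j) F j x).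
    exact: ucontD.
  by apply/funext => x; rewrite big_cons Pi.
by rewrite (_ : (fun _ => _) = fun x => \sum_(j <- r | P j) F j x)//;
  apply/funext => x; rewrite big_cons Pi.
Qed.

Lemma ucont_shift f : ucont f -> ucont (fun x => f (shift x)).
Proof.
move=> uf e e0; have [m fm] := uf _ e0; exists m.+1 => x y xy.
by apply: fm; exact: agree_shift.
Qed.

(** Finitely many words of length [m] provide a point near every [x]; the sum over them stands in
    for a maximum. *)
Lemma ucont_bounded f : ucont f -> exists M : R, forall x, `|f x| <= M.
Proof.
move=> /(_ 1 ltr01)[m fm].
exists (\sum_(t : m.-tuple A) `|f (prepend t point)| + 1) => x.
pose t : m.-tuple A := [tuple of mkseq x m].
have /fm := @agree_prepend_mkseq A m x point.
rewrite -[mkseq x m]/(tval t) => ft.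
have : `|f (prepend t point)| <= \sum_(t : m.-tuple A) `|f (prepend t point)|.
  by rewrite (bigD1 t)//= lerDl sumr_ge0.
move: ft; have := ler_normD (f (prepend t point)) (f x - f (prepend t point)).
rewrite [in X in X -> _]addrC subrK distrC; lra.
Qed.

Lemma ucont_expR f : ucont f -> ucont (fun x => expR (f x)).
Proof.
move=> uf; have [M fM] := ucont_bounded uf => e e0.
(* The exponential lies above its tangent at [u]. *)
have exp1 (u v : R) : u <= M -> expR u - expR v <= expR M * `|u - v|.
  move=> uM; have := expR_ge1Dx (v - u); rewrite expRD expRN => h.
  have : expR u * (1 + (v - u)) <= expR v.
    apply: le_trans (ler_wpM2l (expR_ge0 u) h) _.
    by rewrite mulrCA mulfV ?mulr1// gt_eqF ?expR_gt0.
  have h1 : expR u <= expR M by rewrite ler_expR.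
  have h2 : expR u * (u - v) <= expR u * `|u - v|.
    by rewrite ler_wpM2l ?expR_ge0// ler_norm.
  have h3 : expR u * `|u - v| <= expR M * `|u - v| by rewrite ler_wpM2r.
  lra.
have [m fm] := uf (e / expR M) (divr_gt0 e0 (expR_gt0 M)).
exists m => x y /fm; rewrite ler_pdivlMr ?expR_gt0// mulrC => fxy.
have fM' z : f z <= M := le_trans (ler_norm _) (fM z).
rewrite ler_norml; apply/andP; split.
  by have := exp1 (f y) (f x) (fM' y); rewrite distrC; lra.
by have := exp1 (f x) (f y) (fM' x); lra.
Qed.

Lemma ucont_open_gt f c : ucont f -> open [set x | c < f x].
Proof.
move=> uf; rewrite openE => x /= cfx.
have e0 : 0 < (f x - c) / 2 by rewrite divr_gt0 ?subr_gt0.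
have [m fm] := uf _ e0; apply: (@filterS _ _ _ [set y | agree m x y]).
  by move=> y /fm; rewrite ler_norml /= => /andP[_ ?]; lra.
by apply: open_nbhs_nbhs; split; [exact: open_cylinder|].
Qed.

Lemma ucont_measurable f : ucont f -> measurable_fun setT f.
Proof.
move=> uf; apply: (measurability _ (measurable_realfun.RGenOInfty.measurableE
  R)) => //.
move=> _ [_ [c ->] <-]; rewrite setTI.
rewrite (_ : _ @^-1` _ = [set x | c < f x]).
  by apply: open_measurable_Omega; exact: ucont_open_gt.
by apply/seteqP; split => x /=; rewrite in_itv/= andbT.
Qed.

End uniformly_continuous.

Section equilibrium_functional.
Context (A : pointedFinType) (R : realType) (psi : Omega A -> R).
Context (eta : nat -> R) (E : R).
Implicit Types (f g : Omega A -> R) (x y : Omega A) (e : nat -> R).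

Hypothesis psi1 : forall x, \sum_(a : A) expR (psi (scons a x)) = 1.
Hypothesis psi_eta : forall m a x y, agree m x y ->
  `|psi (scons a x) - psi (scons a y)| <= eta m.
Hypothesis eta_nincr : forall m, eta m.+1 <= eta m.
Hypothesis sum_eta : forall N, \sum_(k < N) eta k <= E.

Lemma modulus_ge0 m : 0 <= eta m.
Proof. exact: le_trans (psi_eta point (@agree_refl _ m point)). Qed.
Let eta_ge0 := modulus_ge0.

(** Adding a letter in front of [s] compares points that already agree on [size s] letters, so each
    modulus [eta k] is used at most once. *)
Lemma birkhoff_distortion s x y :
  `|birkhoff_sum psi (size s) (prepend s x)
    - birkhoff_sum psi (size s) (prepend s y)| <= E.
Proof.
apply: le_trans (sum_eta (size s)).
elim: s => [|a s IH]; first by rewrite /= !birkhoff_sum0 subrr normr0 big_ord0.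
rewrite !prepend_cons [size _]/= !birkhoff_sum_scons big_ord_recr /=.
have xy : agree (size s) (prepend s x) (prepend s y).
  by rewrite -[X in agree X]addn0; exact: agree_prepend.
have := psi_eta a xy; move: IH; rewrite !ler_norml.
by move=> /andP[? ?] /andP[? ?]; apply/andP; split; lra.
Qed.

(** The two pasts are coupled one letter at a time; the state of the chain is a lower bound for
    their agreement, extended by equal letters and otherwise reset to 0. *)
Lemma iter_transfer_modulus f e k m x y : (forall m, e m.+1 <= e m) ->
  (forall m x y, agree m x y -> `|f x - f y| <= e m) ->
  agree m x y ->
  `|iter k (transfer psi) f x - iter k (transfer psi) f y| <=
    iter k (house eta) e m.
Proof.
move=> ee fe; elim: k m x y => [|k IH] m x y xy; first exact: fe.
rewrite !iterS /house -[leRHS]add0r; apply: transfer_coupling => //.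
- elim: m.+1 => // n; apply: le_trans; exact: iter_house_nonincreasing.
- by move=> a; exact: psi_eta.
- by move=> a; rewrite add0r; apply: IH; exact: agree_scons.
- by move=> a b; rewrite add0r; exact: IH.
Qed.

(** A modulus of [f] is majorized by a constant plus an exponential sequence; the stochastic
    operator [house] leaves the constant alone and sends the rest to 0. *)
Lemma iter_transfer_osc_cvg0 f eps : ucont f -> 0 < eps ->
  \forall k \near \oo, forall x y,
    `|iter k (transfer psi) f x - iter k (transfer psi) f y| <= eps.
Proof.
move=> uf eps0; have [M fM] := ucont_bounded uf.
have e2 : 0 < eps / 2 by rewrite divr_gt0.
have [m0 fm0] := uf _ e2.
have h0 : 0 < (2^-1 : R) by rewrite invr_gt0.
have h1 : (2^-1 : R) < 1 by rewrite invf_lt1// ltr1n.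
have M0 : 0 <= M := le_trans (normr_ge0 _) (fM point).
(* With this choice [B * 2^-1 ^+ m] stays above the oscillation [2 * M] as long as [m <= m0]. *)
pose B := 2 * M * 2 ^+ m0.
have B0 : 0 <= B by rewrite !mulr_ge0// exprn_ge0.
pose e m := eps / 2 + B * 2^-1 ^+ m.
have ee m : e m.+1 <= e m.
  by rewrite lerD2l ler_wpM2l// exprS ler_piMl// ?exprn_ge0 ?ltW.
have fe m x y : agree m x y -> `|f x - f y| <= e m.
  move=> xy; have [mm0|mm0] := leqP m0 m.
    by rewrite (le_trans (fm0 x y (agree_le mm0 xy)))// lerDl mulr_ge0.
  have : 2 * M <= B * 2^-1 ^+ m.
    rewrite /B -mulrA ler_peMr ?mulr_ge0// exprVn ler_pdivlMr ?exprn_gt0//.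
    by rewrite mul1r ler_eXn2l ?ltr1n// ltnW.
  have := fM x; have := fM y; rewrite /e ler_norml => /andP[? ?].
  rewrite !ler_norml => /andP[? ?] ?; apply/andP; split; lra.
have c0 := iter_house_exp_cvg0 eta_ge0 sum_eta h0 h1.
have : B * iter n (house eta) (fun m => 2^-1 ^+ m) 0 @[n --> \oo] --> B * 0.
  exact: cvgMl_tmp.
rewrite mulr0 => /cvgrPdist_le /(_ _ e2); apply: filterS => k hk x y.
have := @iter_transfer_modulus f e k 0 x y ee fe (@agree0 _ x y).
rewrite /e iter_house_affine.
by move: hk; rewrite sub0r normrN ler_norml => /andP[_ ?]; lra.
Qed.

(** The base point does not matter, because the oscillation of the iterates tends to 0. *)
Definition gint f : R := limn (fun n => iter n (transfer psi) f point).

(** All further iterates are averages of values of the [k]-th one; this yields the Cauchy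
    property. *)
Lemma iter_transfer_near f k eps x : (forall x y,
    `|iter k (transfer psi) f x - iter k (transfer psi) f y| <= eps) ->
  forall j, `|iter k (transfer psi) f x - iter (j + k) (transfer psi) f x| <=
    eps.
Proof.
move=> fk j; rewrite iterD; set h := iter k _ f in fk *.
have h1 : iter j (transfer psi) h x <= h x + eps.
  apply: iter_transfer_le => // y.
  by have := fk y x; rewrite ler_norml => /andP[]; lra.
have h2 : h x - eps <= iter j (transfer psi) h x.
  apply: iter_transfer_ge => // y.
  by have := fk y x; rewrite ler_norml => /andP[]; lra.
by rewrite ler_norml; apply/andP; split; lra.
Qed.

Lemma gint_cvg f x : ucont f -> iter n (transfer psi) f x @[n --> \oo] --> gint
  f.
Proof.
move=> uf.
have c0 : cvgn (fun n => iter n (transfer psi) f point).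
  apply/cauchy_cvgP/cauchy_exP => eps eps0.
  have e2 : 0 < eps / 2 by rewrite divr_gt0.
  have [N _ /(_ N (leqnn N)) HN] := iter_transfer_osc_cvg0 uf e2.
  exists (iter N (transfer psi) f point); exists N => // n Nn.
  rewrite /= -ball_normE /= -(subnK Nn).
  by apply: le_lt_trans (iter_transfer_near _ HN _) _; lra.
have -> : (fun n => iter n (transfer psi) f x) = (fun n =>
    iter n (transfer psi) f point +
    (iter n (transfer psi) f x - iter n (transfer psi) f point)).
  by apply/funext => n; rewrite addrC subrK.
rewrite -[gint f]addr0; apply: cvgD => //.
apply/cvgrPdist_le => eps eps0; apply: filterS (iter_transfer_osc_cvg0 uf eps0).
by move=> n; rewrite sub0r normrN; exact.
Qed.

Lemma gint_eq f l : ucont f ->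
  iter n (transfer psi) f point @[n --> \oo] --> l -> gint f = l.
Proof. by move=> uf; apply: cvg_unique (gint_cvg point uf). Qed.

Lemma gint_cst c : gint (fun=> c) = c.
Proof.
apply: gint_eq; first exact: ucont_cst.
under eq_fun do rewrite iter_transfer_cst//.
exact: cvg_cst.
Qed.

Lemma le_gint f g : ucont f -> ucont g -> (forall x, f x <= g x) ->
  gint f <= gint g.
Proof.
move=> uf ug fg; apply: ler_cvg_to (gint_cvg point uf) (gint_cvg point ug) _.
by apply: nearW => n; exact: le_iter_transfer.
Qed.

Lemma gintZ c f : ucont f -> gint (fun x => c * f x) = c * gint f.
Proof.
move=> uf; apply: gint_eq; first exact: ucontZ.
under eq_fun do rewrite iter_transferZ.
by apply: cvgMl_tmp; exact: gint_cvg.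
Qed.

Lemma gintD f g : ucont f -> ucont g ->
  gint (fun x => f x + g x) = gint f + gint g.
Proof.
move=> uf ug; apply: gint_eq; first exact: ucontD.
under eq_fun do rewrite iter_transferD.
by apply: cvgD; exact: gint_cvg.
Qed.

Lemma gint_sum (I : Type) (r : seq I) (P : pred I) (F : I -> Omega A -> R) :
  (forall i, ucont (F i)) ->
  gint (fun x => \sum_(i <- r | P i) F i x) = \sum_(i <- r | P i) gint (F i).
Proof.
move=> uF; apply: gint_eq; first exact: ucont_sum.
under eq_fun do rewrite iter_transfer_sum.
by apply: cvg_big => [|i _]; [exact: add_continuous|exact: gint_cvg].
Qed.

Lemma gint_iter_transfer k f l : ucont f -> (forall x, l <= iter k (transfer
  psi) f x) ->
  l <= gint f.
Proof.
move=> uf kl; apply: (cvgr_to_ge (gint_cvg point uf)).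
exists k => // n kn; rewrite /= -(subnK kn) iterD; exact: iter_transfer_ge.
Qed.

Lemma gint_iter_transfer_le k f l : ucont f ->
  (forall x, iter k (transfer psi) f x <= l) -> gint f <= l.
Proof.
move=> uf kl; apply: (cvgr_to_le (gint_cvg point uf)).
exists k => // n kn; rewrite /= -(subnK kn) iterD; exact: iter_transfer_le.
Qed.

(** The transfer operator is a left inverse of composition with the shift, so the sequence of
    iterates is only delayed by one step. *)
Lemma gint_shift f : ucont f -> gint (fun x => f (shift x)) = gint f.
Proof.
move=> uf; apply: gint_eq; first exact: ucont_shift.
rewrite -(cvg_shiftS (fun n => iter n (transfer psi) (fun x =>
  f (shift x)) point)).
rewrite /=; under eq_fun do rewrite -iterS iterSr.
rewrite (_ : transfer psi (fun x => f (shift x)) = f); first exact: gint_cvg.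
by apply/funext => x; exact: transfer_comp_shift.
Qed.

End equilibrium_functional.

(** * Measures with prescribed cylinder weights *)

Section cylinder_generators.
Context (A : pointedFinType).
Implicit Types (s : seq A).

Definition cylinders : set (set (Omega A)) :=
  [set C | C = set0 \/ exists s, C = cylinder s].

Lemma cylinder_nil : cylinder [::] = [set: Omega A].
Proof. exact/seteqP. Qed.

Lemma measurable_cylinder s : measurable (cylinder s).
Proof. exact: cylindrical_measurable (@cylindrical_cylinder _ s). Qed.

Lemma cylindrical_bigcup m (C : set (Omega A)) : cylindrical m C ->
  C = \big[setU/set0]_(t : m.-tuple A | `[< cylinder t `<=` C >]) cylinder t.
Proof.
move=> mC; apply/seteqP; split => x.
  move=> Cx; rewrite -bigcup_seq_cond.
  exists [tuple of mkseq x m] => /=; last by rewrite /cylinder/= size_mkseq.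
  rewrite mem_index_enum/=; apply/asboolP => y.
  rewrite /cylinder /= size_mkseq => /agree_mkseq yx.
  by apply: mC Cx; exact: agree_sym.
by rewrite -bigcup_seq_cond => -[t /= /andP[_ /asboolP tC] /tC].
Qed.

(** There are finitely many words of each length, so an open set is a countable union of
    cylinders. *)
Lemma measurable_cylindersE : measurable = <<s cylinders >> :> set (set (Omega
  A)).
Proof.
apply/seteqP; split.
  apply: smallest_sub; first exact: smallest_sigma_algebra.
  move=> U oU; rewrite (open_bigcup_cylindrical oU).
  apply: (@bigcup_measurable _ (g_sigma_algebraType cylinders)) => m _.
  rewrite (cylindrical_bigcup (@cylindrical_interior _ m U)).
  apply: (@bigsetU_measurable _ (g_sigma_algebraType cylinders)) => t _.
  by apply: sub_sigma_algebra; right; exists t.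
apply: smallest_sub.
  split; first exact: measurable0.
    by move=> B mB; rewrite setTD; exact: measurableC.
  by move=> F mF; exact: bigcupT_measurable.
move=> C [->|[s ->]]; [exact: measurable0|exact: measurable_cylinder].
Qed.

(** The longer word either extends the shorter one or contradicts it; hence the cylinders and the
    empty set form a pi-system. *)
Lemma cylinder_sub s s' : (size s <= size s')%N ->
  cylinder s `&` cylinder s' = set0 \/ cylinder s `&` cylinder s' = cylinder s'.
Proof.
move=> ss'; have [[x [xs xs']]|] := pselect (cylinder s `&` cylinder s' !=set0).
  right; apply/seteqP; split => [y [_ //]|y ys']; split => //.
  rewrite /cylinder/= -[RHS]xs; apply/agree_mkseq; apply: agree_le ss' _.
  by apply/agree_mkseq; rewrite ys' xs'.
by move/set0P/negP/negPn/eqP; left.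
Qed.

Lemma setI_closed_cylinders : setI_closed cylinders.
Proof.
move=> C D [->|[s ->]]; first by rewrite set0I; left.
move=> [->|[s' ->]]; first by rewrite setI0; left.
have [ss'|ss'] := leqP (size s) (size s').
  by have [->|->] := cylinder_sub ss'; [left|right; exists s'].
by rewrite setIC; have [->|->] := cylinder_sub (ltnW ss'); [left|right;
  exists s].
Qed.

Lemma cylinder_measurable_fun d (T : measurableType d) (f : T -> Omega A) :
  (forall s, measurable (f @^-1` cylinder s)) -> measurable_fun setT f.
Proof.
move=> mf; apply: (measurability _ measurable_cylindersE).
move=> _ [C [->|[s ->]] <-]; rewrite setTI; last exact: mf.
by rewrite preimage_set0; exact: measurable0.
Qed.

Lemma cylinder_measure_unique (R : realType) (mu nu : probability (Omega A) R) :
  (forall s, mu (cylinder s) = nu (cylinder s)) ->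
  forall B, measurable B -> mu B = nu B.
Proof.
move=> mn B mB; apply: (@measure_unique _ R _ cylinders (fun=> setT)
  measurable_cylindersE setI_closed_cylinders _ _ mu nu) => //.
- by move=> _; right; exists [::]; rewrite cylinder_nil.
- by rewrite bigcup_const//; exists 0%N.
- by move=> C [->|[s ->]]; [rewrite !measure0|exact: mn].
- by move=> _; rewrite -ge0_fin_numE//; exact: fin_num_measure.
Qed.

Lemma measurable_shift : measurable_fun setT (@shift A).
Proof.
apply: cylinder_measurable_fun => s.
apply: (@cylindrical_measurable _ (size s).+1) => x y xy.
by move/agree_shift/agree_mkseq : xy => e; rewrite /cylinder/= e.
Qed.

End cylinder_generators.

Section cylinder_measure.
Context (A : pointedFinType) (R : realType) (m : seq A -> R).
Implicit Types (s : seq A) (a : A) (t : R).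

Hypothesis m_ge0 : forall s, 0 <= m s.
Hypothesis m_nil : m [::] = 1.
Hypothesis m_rcons : forall s, m s = \sum_(a : A) m (rcons s a).

(* [0, 1[ is cut into consecutive intervals [piece s] of length [m s], the
   pieces of [rcons s a] subdividing that of [s]; a point is coded by the word
   of the pieces that contain it. *)
Let below s j := \sum_(b : A | (enum_rank b < j)%N) m (rcons s b).

Let extend (p : seq A * R) a := (rcons p.1 a, p.2 + below p.1 (enum_rank a)).

Let left s := (foldl extend ([::], 0) s).2.

Let piece s := `[left s, left s + m s[.

Let left_rcons s a : left (rcons s a) = left s + below s (enum_rank a).
Proof.
have fst u : (foldl extend ([::], 0) u).1 = u.
  by elim/last_ind: u => // u b IH; rewrite foldl_rcons /= IH.
by rewrite /left foldl_rcons /= fst.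
Qed.

Let below0 s : below s 0 = 0. Proof. by rewrite /below big_pred0. Qed.

Let belowS s (j : 'I_#|A|) : below s j.+1 = below s j + m (rcons s (enum_val
  j)).
Proof.
rewrite /below (bigD1 (enum_val j)) ?enum_valK//= addrC; congr (_ + _).
apply: eq_bigl => b; rewrite ltnS ltn_neqAle andbC; congr (_ && _).
by rewrite -(inj_eq enum_rank_inj) enum_valK.
Qed.

Let below_le s i j : (i <= j)%N -> below s i <= below s j.
Proof.
move=> ij; rewrite /below big_mkcond [leRHS]big_mkcond; apply: ler_sum => b _.
have [bi|bi] := ltnP (enum_rank b) i; first by rewrite (leq_trans bi ij).
by case: ifP.
Qed.

Let below_card s : below s #|A| = m s.
Proof. by rewrite m_rcons /below; apply: eq_bigl => b; rewrite ltn_ord. Qed.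

Let pieceP s a t : (t \in piece (rcons s a)) =
  (left s + below s (enum_rank a) <= t < left s + below s (enum_rank a).+1).
Proof. by rewrite in_itv/= left_rcons belowS enum_rankK addrA. Qed.

Let piece_rcons s a t : t \in piece (rcons s a) -> t \in piece s.
Proof.
rewrite pieceP in_itv/= => /andP[h1 h2]; apply/andP; split.
  by apply: le_trans h1; rewrite lerDl -(below0 s) below_le.
by apply: lt_le_trans h2 _; rewrite lerD2l -below_card below_le.
Qed.

Let piece_inj s a b t :
  t \in piece (rcons s a) -> t \in piece (rcons s b) -> a = b.
Proof.
wlog ab : a b / (enum_rank a <= enum_rank b)%N.
  move=> wlg ta tb; have [ab|ba] := leqP (enum_rank a) (enum_rank b).
    exact: wlg.
  by apply/esym/wlg => //; exact: ltnW.
rewrite !pieceP => /andP[_ h1] /andP[h2 _].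
move: ab; rewrite leq_eqVlt => /predU1P[/val_inj/enum_rank_inj//|ab].
by exfalso; have := below_le s ab; lra.
Qed.

Let piece_cover s t : t \in piece s -> exists a, t \in piece (rcons s a).
Proof.
rewrite in_itv/= -below_card => /andP[h1 h2].
have ex : exists j, t < left s + below s j by exists #|A|.
(* The least index whose bound exceeds [t] is not 0, and [t] lies in the subinterval that ends at
   this bound. *)
case: (ex_minnP ex) => -[|j] tj jmin.
  by move: tj; rewrite below0; lra.
have jA : (j < #|A|)%N by exact: (jmin #|A|).
exists (enum_val (Ordinal jA)); rewrite pieceP enum_valK tj andbT leNgt.
by apply/negP => /jmin; rewrite ltnn.
Qed.

Let pick_letter s t := odflt point [pick a | t \in piece (rcons s a)].

Fixpoint coding_word t n : seq A :=
  if n is n'.+1 then rcons (coding_word t n') (pick_letter (coding_word t n') t)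
  else [::].

(** Outside [[0, 1[] the value is arbitrary. For the uniform law on [[0, 1]] this concerns only the
    endpoint 1, a null set. *)
Definition coding t : Omega A :=
  fun n => if t \in `[0, 1[ then pick_letter (coding_word t n) t else point.

Let pick_letterE s a t : t \in piece (rcons s a) -> pick_letter s t = a.
Proof.
rewrite /pick_letter => ta; case: pickP => [b tb|/(_ a)]; last by rewrite ta.
exact: piece_inj tb ta.
Qed.

Let coding_cylinder t s : t \in `[0, 1[ ->
  cylinder s (coding t) <-> t \in piece s.
Proof.
move=> t01; have W n : mkseq (coding t) n = coding_word t n.
  by elim: n => //= n IH; rewrite mkseqS IH /coding t01.
elim/last_ind: s => [|s a IH].
  by rewrite cylinder_nil /piece m_nil /left /= add0r t01.
rewrite /cylinder /= size_rcons mkseqS.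
have {}IH : mkseq (coding t) (size s) = s <-> t \in piece s := IH.
have cE : t \in piece s -> coding t (size s) = pick_letter s t.
  by move=> /IH sE; rewrite /coding t01 -W sE.
split => [|ta].
  move/rcons_inj => [/IH ts <-]; rewrite cE//.
  by have [b tb] := piece_cover ts; rewrite (pick_letterE tb).
have ts := piece_rcons ta.
by have /IH-> := ts; rewrite cE// (pick_letterE ta).
Qed.

Let preimage_coding s : coding @^-1` cylinder s =
  ([set` piece s] `&` `[0, 1[) `|` (~` `[0, 1[ `&` [set _ | cylinder s (fun=>
    point)]).
Proof.
apply/seteqP; split => t /=; have [t01|t01] := boolP (t \in `[0, 1[).
- by move=> /coding_cylinder h; left; split => //; exact: h.
- by rewrite /coding (negbTE t01) => h; right; split => //; exact/negP.
- by case=> [[ts _]|[]//]; exact/coding_cylinder.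
- by case=> [[_ //]|[_]]; rewrite /coding (negbTE t01).
Qed.

Let measurable_coding : measurable_fun [set: measurableTypeR R] coding.
Proof.
apply: cylinder_measurable_fun => s; rewrite preimage_coding.
apply: measurableU; apply: measurableI => //; first exact: measurableC.
have [h|h] := pselect (cylinder s (fun=> point)).
  by rewrite (propT h); exact: measurableT.
by rewrite (propF h); exact: measurable0.
Qed.

Lemma cylinder_measure_exists :
  exists mu : probability (Omega A) R, forall s, mu (cylinder s) = (m s)%:E.
Proof.
pose X : {mfun measurableTypeR R >-> Omega A} :=
  HB.pack (coding : measurableTypeR R -> Omega A)
    (@isMeasurableFun.Build _ _ (measurableTypeR R) (Omega A) coding
       measurable_coding).
pose P : probability _ R := uniform_prob (@ltr01 R).
exists (distribution P X) => s.
rewrite /distribution /pushforward /= preimage_coding.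
set U := _ `|` _; have mU : measurable (U : set (measurableTypeR R)).
  by rewrite /U -preimage_coding -[X in measurable X]setTI;
    apply: measurable_coding => //; exact: measurable_cylinder.
have sub01 : [set` piece s] `<=` `[0, 1[.
  elim/last_ind: (s) => [|r a IH] t.
    by rewrite /piece m_nil /left /= add0r.
  by move/piece_rcons/IH.
have -> : P U = lebesgue_measure (U `&` `[0, 1]).
  transitivity (\int[lebesgue_measure]_(x in U) (uniform_pdf 0 1 x)%:E)%E => //.
  rewrite integral_uniform_pdf (eq_integral (cst 1%E)) => [|x].
    by rewrite integral_cst ?mul1e//; exact: measurableI.
  by rewrite inE => -[_ /=]; rewrite in_itv/= => x01;
    rewrite /uniform_pdf x01 subr0 invr1.
have piece_measure : lebesgue_measure [set` piece s] = (m s)%:E.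
  rewrite /piece lebesgue_measure_itv/= lte_fin ltrDl lt_neqAle m_ge0 andbT.
  case: eqP => [<-//|_].
  by rewrite -EFinB addrAC subrr add0r.
rewrite -piece_measure; apply/eqP; rewrite eq_le; apply/andP; split.
  (* The preimage may exceed the piece by the endpoint 1, which has measure 0. *)
  apply: (@le_trans _ _ (lebesgue_measure ([set` piece s] `|` [set 1]))).
    apply: le_measure; rewrite ?inE; [exact: measurableI|exact: measurableU|].
    move=> t [[[ts _]|[/= nt _]] /=]; first by left.
    rewrite in_itv/= => /andP[t0 t1]; right => /=; apply/eqP.
    by rewrite eq_le t1 leNgt; apply/negP => t1'; apply: nt;
      rewrite in_itv/= t0.
  apply: le_trans (measureU2 _ _ _) _ => //.
  by rewrite [X in (_ + X)%E]lebesgue_measure_set1 adde0.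
apply: le_measure; rewrite ?inE//; first exact: measurableI.
move=> t ts; split; first by left; split => //; exact: sub01.
by have := sub01 _ ts; rewrite /= !in_itv/= => /andP[-> /ltW].
Qed.

End cylinder_measure.

(** * Means, itineraries and approximation by cylinders *)

Section bounded_means.
Context d (T : measurableType d) (R : realType) (mu : probability T R).
Implicit Types (f g : T -> R) (B : set T).

Definition bounded_measurable f :=
  measurable_fun setT f /\ exists M : R, forall x, `|f x| <= M.

Lemma bounded_measurable_integrable f :
  bounded_measurable f -> mu.-integrable setT (EFin \o f).
Proof.
move=> [mf [M fM]]; apply: measurable_bounded_integrable => //.
  by rewrite -ge0_fin_numE//; exact: fin_num_measure.
by exists M; split; rewrite ?num_real // => x Mx y _ /=;
  rewrite (le_trans _ (ltW Mx)).
Qed.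

Lemma Rintegral_EFin f : bounded_measurable f ->
  (\int[mu]_x (f x)%:E)%E = (\int[mu]_x f x)%:E.
Proof.
move=> /bounded_measurable_integrable fi; rewrite /Rintegral fineK//.
exact: integrable_fin_num.
Qed.

Lemma bounded_measurable_cst c : bounded_measurable (fun=> c).
Proof. by split; [exact: measurable_cst|exists `|c|]. Qed.

Lemma bounded_measurableD f g : bounded_measurable f -> bounded_measurable g ->
  bounded_measurable (fun x => f x + g x).
Proof.
move=> [mf [M fM]] [mg [N gN]]; split; first exact: measurable_funD.
by exists (M + N) => x; rewrite (le_trans (ler_normD _ _))// lerD.
Qed.

Lemma bounded_measurableZ c f : bounded_measurable f ->
  bounded_measurable (fun x => c * f x).
Proof.
move=> [mf [M fM]]; split; first exact: measurable_funM.
by exists (`|c| * M) => x; rewrite normrM ler_wpM2l.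
Qed.

Lemma bounded_measurable_indic B : measurable B -> bounded_measurable (\1_B).
Proof.
move=> mB; split; first exact: measurable_indic.
by exists 1 => x; rewrite indicE; case: (x \in B); rewrite ?normr1// normr0.
Qed.

Lemma bounded_measurable_sum (I : Type) (r : seq I) (F : I -> T -> R) :
  (forall i, bounded_measurable (F i)) ->
  bounded_measurable (fun x => \sum_(i <- r) F i x).
Proof.
move=> bF; elim: r => [|i r IH].
  rewrite (_ : (fun _ => _) = fun=> 0); first exact: bounded_measurable_cst.
  by apply/funext => x; rewrite big_nil.
rewrite (_ : (fun _ => _) = fun x => F i x + \sum_(j <- r) F j x).
  exact: bounded_measurableD.
by apply/funext => x; rewrite big_cons.
Qed.

Lemma bounded_measurable_comp (h : T -> T) f : measurable_fun setT h ->
  bounded_measurable f -> bounded_measurable (fun x => f (h x)).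
Proof.
move=> mh [mf [M fM]]; split; first exact: (measurableT_comp mf mh).
by exists M => x.
Qed.

Lemma mean_cst c : \int[mu]_x (fun=> c) x = c.
Proof.
rewrite Rintegral_cst//.
by rewrite [fine _](congr1 fine (probability_setT mu)) mulr1.
Qed.

Lemma meanD f g : bounded_measurable f -> bounded_measurable g ->
  \int[mu]_x (f x + g x) = \int[mu]_x f x + \int[mu]_x g x.
Proof.
by move=> bf bg; rewrite RintegralD//; exact: bounded_measurable_integrable.
Qed.

Lemma meanZ c f : bounded_measurable f ->
  \int[mu]_x (c * f x) = c * \int[mu]_x f x.
Proof.
by move=> bf; rewrite RintegralZl//; exact: bounded_measurable_integrable.
Qed.

Lemma le_mean f g : bounded_measurable f -> bounded_measurable g ->
  (forall x, f x <= g x) -> \int[mu]_x f x <= \int[mu]_x g x.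
Proof.
by move=> bf bg fg; apply: le_Rintegral => //;
  exact: bounded_measurable_integrable.
Qed.

Lemma mean_sum (I : Type) (r : seq I) (F : I -> T -> R) :
  (forall i, bounded_measurable (F i)) ->
  \int[mu]_x (\sum_(i <- r) F i x) = \sum_(i <- r) \int[mu]_x F i x.
Proof.
move=> bF; elim: r => [|i r IH].
  rewrite big_nil -[RHS]mean_cst; congr Rintegral.
  by apply/funext => x; rewrite big_nil.
rewrite big_cons -IH -meanD//; last exact: bounded_measurable_sum.
by congr Rintegral; apply/funext => x; rewrite big_cons.
Qed.

Lemma mean_indic B : measurable B -> \int[mu]_x \1_B x = fine (mu B).
Proof. by move=> mB; rewrite /Rintegral integral_indic// setIT. Qed.

End bounded_means.

Section itineraries.
Context d (T : measurableType d) (R : realType) (mu : probability T R).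
Context (f : T -> T) (mf : measurable_fun setT f).
Context (k : nat) (P : T -> 'I_k) (mP : finite_partition P).

Definition itinerary n x : n.-tuple 'I_k := [tuple P (iter i f x) | i < n].

Lemma join_cellE n (w : n.-tuple 'I_k) x : join_cell f P w x <-> itinerary n x
  = w.
Proof.
split => [xw|<- i]; last by rewrite tnth_mktuple.
by apply: eq_from_tnth => i; rewrite tnth_mktuple.
Qed.

Lemma measurable_iter n : measurable_fun setT (iter n f).
Proof.
elim: n => [|n IH]; first exact: measurable_id.
exact: (measurableT_comp mf IH).
Qed.

Lemma measurable_join_cell n (w : n.-tuple 'I_k) : measurable (join_cell f P w).
Proof.
rewrite (_ : join_cell f P w =
    \big[setI/setT]_(i < n) (iter i f @^-1` (P @^-1` [set tnth w i]))).
  apply: bigsetI_measurable => i _.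
  by rewrite -[X in measurable X]setTI; apply: measurable_iter => //; exact: mP.
apply/seteqP; split => x.
  by move=> xw; rewrite -bigcap_seq => i _; exact: xw.
by rewrite -bigcap_seq => xw i; apply: xw; rewrite /= mem_index_enum.
Qed.

Lemma sum_join_cell n (c : n.-tuple 'I_k -> R) x :
  \sum_w c w * \1_(join_cell f P w) x = c (itinerary n x).
Proof.
rewrite (bigD1 (itinerary n x))//= big1 => [|w wx].
  by rewrite addr0 indicE mem_set ?mulr1//; exact/join_cellE.
rewrite indicE memNset ?mulr0// => /join_cellE xw.
by rewrite xw eqxx in wx.
Qed.

Lemma bounded_measurable_itinerary n (c : n.-tuple 'I_k -> R) :
  bounded_measurable (fun x => c (itinerary n x)).
Proof.
rewrite (_ : (fun _ => _) = fun x => \sum_w c w * \1_(join_cell f P w) x).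
  apply: bounded_measurable_sum => w; apply: bounded_measurableZ.
  exact/bounded_measurable_indic/measurable_join_cell.
by apply/funext => x; rewrite sum_join_cell.
Qed.

(** Sums over words weighted by the measures of cells become integrals, where monotonicity and shift
    invariance can be used; this is how the entropy sums are evaluated. *)
Lemma mean_itinerary n (c : n.-tuple 'I_k -> R) :
  \sum_w fine (mu (join_cell f P w)) * c w = \int[mu]_x c (itinerary n x).
Proof.
under [RHS]eq_Rintegral do rewrite -sum_join_cell.
rewrite mean_sum => [|w]; last first.
  exact/bounded_measurableZ/bounded_measurable_indic/measurable_join_cell.
apply: eq_bigr => w _; rewrite meanZ; last first.
  exact/bounded_measurable_indic/measurable_join_cell.
rewrite mulrC; congr (_ * _); apply/esym/mean_indic.
exact: measurable_join_cell.
Qed.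

Lemma sum_measure_join_cell n :
  \sum_(w : n.-tuple 'I_k) fine (mu (join_cell f P w)) = 1.
Proof.
transitivity (\sum_(w : n.-tuple 'I_k) fine (mu (join_cell f P w)) * 1).
  by apply: eq_bigr => w _; rewrite mulr1.
by rewrite (mean_itinerary (fun=> 1)); exact: mean_cst.
Qed.

End itineraries.

(** The bound [ln (1 + t) <= t] at [t = q i / p i - 1], summed with weights [p i]; terms with
    [p i = 0] are treated apart. *)
Lemma gibbs_inequality (R : realType) (I : finType) (p q : I -> R) :
  (forall i, 0 <= p i) -> (forall i, 0 < q i) ->
  \sum_i p i = 1 -> \sum_i q i <= 1 ->
  - \sum_i p i * ln (p i) <= - \sum_i p i * ln (q i).
Proof.
move=> p0 q0 p1 q1; rewrite lerN2.
suff : \sum_i (p i * ln (q i) - p i * ln (p i)) <= \sum_i (q i - p i).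
  by rewrite !sumrB p1; lra.
apply: ler_sum => i _; have := p0 i; rewrite le_eqVlt => /predU1P[<-|pi0].
  by rewrite !mul0r !subr0 ltW.
have -> : p i * ln (q i) - p i * ln (p i) = p i * ln (1 + (q i / p i - 1)).
  by rewrite [1 + _]addrC subrK ln_div ?posrE// mulrBr.
have -> : q i - p i = p i * (q i / p i - 1).
  by rewrite mulrBr mulr1 mulrC divfK// gt_eqF.
rewrite ler_pM2l// le_ln1Dx//.
by rewrite ltrBrDr addNr divr_gt0.
Qed.

Section cylindrical_approximation.
Context (A : pointedFinType) (R : realType) (nu : probability (Omega A) R).
Implicit Types (B C D : set (Omega A)).

Let sd B C := (B `\` C) `|` (C `\` B).

Let msd B C : measurable B -> measurable C -> measurable (sd B C).
Proof. by move=> mB mC; apply: measurableU; exact: measurableD. Qed.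

(** These sets form a sigma-algebra that contains the open sets. *)
Let approximable : set (set (Omega A)) := [set B | measurable B /\
  forall eps : R, 0 < eps -> exists m C, cylindrical m C /\ (nu (sd B C) <=
    eps%:E)%E].

Let sd_setC B C : sd (~` B) (~` C) = sd B C.
Proof. by rewrite /sd !setDE !setCK setUC [C `&` _]setIC [B `&` _]setIC. Qed.

Let sd_setU B C B' C' : sd (B `|` B') (C `|` C') `<=` sd B C `|` sd B' C'.
Proof. rewrite /sd => x /=; tauto. Qed.

Let nu_sub2 B C D : measurable B -> measurable C -> measurable D ->
  B `<=` C `|` D -> forall e1 e2 : R, (nu C <= e1%:E)%E -> (nu D <= e2%:E)%E ->
  (nu B <= (e1 + e2)%:E)%E.
Proof.
move=> mB mC mD BCD e1 e2 C1 D2; rewrite EFinD.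
apply: le_trans (leeD C1 D2); apply: le_trans (measureU2 _ mC mD).
by apply: le_measure; rewrite ?inE//; exact: measurableU.
Qed.

Let approximableU B C : approximable B -> approximable C -> approximable (B `|`
  C).
Proof.
move=> [mB aB] [mC aC]; split; first exact: measurableU.
move=> eps e0; have e2 : 0 < eps / 2 by rewrite divr_gt0.
have [m [B' [mB' hB]]] := aB _ e2; have [n [C' [mC' hC]]] := aC _ e2.
exists (maxn m n), (B' `|` C'); split.
  move=> x y xy [Bx|Cx]; [left|right].
    by apply: mB' Bx; apply: agree_le xy; exact: leq_maxl.
  by apply: mC' Cx; apply: agree_le xy; exact: leq_maxr.
have mB'' := cylindrical_measurable mB';
  have mC'' := cylindrical_measurable mC'.
rewrite [eps]splitr; apply: nu_sub2 hB hC; last exact: sd_setU.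
- by apply: msd; exact: measurableU.
- exact: msd.
- exact: msd.
Qed.

Let approximable_cylindrical m C : cylindrical m C -> approximable C.
Proof.
move=> mC; split; first exact: cylindrical_measurable mC.
move=> e e0; exists m, C; split => //; rewrite /sd setDv setU0 measure0 lee_fin.
exact: ltW.
Qed.

Let approximable_bigcup (F : (set (Omega A))^nat) :
  (forall i, approximable (F i)) -> approximable (\bigcup_i F i).
Proof.
move=> aF; have mF i : measurable (F i) by have [] := aF i.
have mU : measurable (\bigcup_i F i) by exact: bigcup_measurable.
split => // eps e0; have e2 : 0 < eps / 2 by rewrite divr_gt0.
pose D n := \big[setU/set0]_(i < n) F i.
have aD n : approximable (D n).
  rewrite /D; elim/big_ind : _ => [||i _ //].
    exact: (@approximable_cylindrical 0).
  exact: approximableU.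
(* Continuity from above reduces the countable union to a finite one, at the price of half the
   error. *)
have [n Dn] : exists n, (nu (\bigcup_i F i `\` D n) <= (eps / 2)%:E)%E.
  pose G n := \bigcup_i F i `\` D n.
  have mG n : measurable (G n) by apply: measurableD => //; exact: (aD n).1.
  have G0 : \bigcap_n G n = set0.
    apply/seteqP; split => // x xG; have [[i _ Fix] _] := xG 0%N Logic.I.
    have [_] := xG i.+1 Logic.I; apply; rewrite /D -bigcup_mkord.
    by exists i => //=.
  have : nu \o G @ \oo --> nu (\bigcap_n G n).
    apply: nonincreasing_cvg_mu => //.
    - by rewrite -ge0_fin_numE//; exact: fin_num_measure.
    - by rewrite G0; exact: measurable0.
    - move=> i j ij; apply/subsetPset; apply: setDS; rewrite /D.
      exact: subset_bigsetU.
  rewrite G0 measure0 => /fine_cvg/cvgrPdist_le/(_ _ e2)[n _ /(_ n (leqnn n))].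
  rewrite /= sub0r normrN => hn; exists n.
  have nuG : nu (G n) \is a fin_num by apply: fin_num_measure; exact: mG.
  rewrite -/(G n) -[leLHS](fineK nuG).
  by rewrite lee_fin; exact: le_trans (ler_norm _) hn.
have [m [C [mC hC]]] := (aD n).2 _ e2.
exists m, C; split => //; have mC' := cylindrical_measurable mC.
have mD := (aD n).1.
have DF : D n `<=` \bigcup_i F i by exact: bigsetU_bigcup.
rewrite [eps]splitr; apply: nu_sub2 Dn hC;
  [exact: msd|exact: measurableD|exact: msd|].
move=> x [[Fx nCx]|[Cx nFx]].
  by have [Dx|Dx] := pselect (D n x); [right; left|left].
by right; right; split => // /DF.
Qed.

Lemma approximable_measurable B : measurable B ->
  forall eps : R, 0 < eps -> exists m C, cylindrical m C /\
    (nu ((B `\` C) `|` (C `\` B)) <= eps%:E)%E.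
Proof.
move=> mB; suff : approximable B by case.
move: B mB; apply: smallest_sub.
  split; first exact: (@approximable_cylindrical 0).
    move=> B [mB aB]; rewrite setTD; split; first exact: measurableC.
    move=> e /aB[m [C [mC hC]]]; exists m, (~` C); rewrite -/(sd _ _) sd_setC.
    by split => // x y xy /= nCx Cy; apply: nCx; apply: mC Cy; exact: agree_sym.
  exact: approximable_bigcup.
move=> U oU; rewrite (open_bigcup_cylindrical oU);
  apply: approximable_bigcup => m.
apply: (@approximable_cylindrical m); exact: cylindrical_interior.
Qed.

End cylindrical_approximation.

(** * The invariant measure of a g-function *)

Section shift_invariance.
Context (A : pointedFinType) (R : realType).
Implicit Types (f : Omega A -> R) (nu : probability (Omega A) R).

Lemma ucont_bounded_measurable f : ucont f -> bounded_measurable f.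
Proof. by move=> uf; split; [exact: ucont_measurable|exact: ucont_bounded]. Qed.

Definition shift_mfun : {mfun Omega A >-> Omega A} :=
  HB.pack (@shift A) (@isMeasurableFun.Build _ _ (Omega A) (Omega A) (@shift A)
    (@measurable_shift A)).

Lemma mean_shift nu f : shift_invariant nu -> bounded_measurable f ->
  \int[nu]_x f (shift x) = \int[nu]_x f x.
Proof.
move=> inv bf; rewrite /Rintegral; congr fine.
transitivity (\int[distribution nu shift_mfun]_x (f x)%:E)%E.
  rewrite integral_distribution//; first by apply/measurable_EFinP; case: bf.
  apply: (@bounded_measurable_integrable _ _ _ nu (fun x => f (shift x))).
  exact: bounded_measurable_comp (@measurable_shift A) bf.
by apply: eq_measure_integral => B mB _; exact: inv.
Qed.

Lemma bounded_measurable_iter_shift n f : bounded_measurable f ->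
  bounded_measurable (fun x => f (iter n (@shift A) x)).
Proof.
move=> bf; apply: bounded_measurable_comp => //.
exact: measurable_iter (@measurable_shift A) n.
Qed.

Lemma bounded_measurable_birkhoff n f :
  bounded_measurable f -> bounded_measurable (birkhoff_sum f n).
Proof.
move=> bf; apply: bounded_measurable_sum => i.
exact: bounded_measurable_iter_shift.
Qed.

Lemma mean_birkhoff nu n f : shift_invariant nu -> bounded_measurable f ->
  \int[nu]_x birkhoff_sum f n x = n%:R * \int[nu]_x f x.
Proof.
move=> inv bf; rewrite mean_sum => [|i];
  last exact: bounded_measurable_iter_shift.
rewrite (eq_bigr (fun=> \int[nu]_x f x)) => [|i _].
  by rewrite sumr_const_nat subn0 mulr_natl.
elim: i => [|i IH]; first by [].
rewrite -[RHS]IH -[RHS]mean_shift//; last exact: bounded_measurable_iter_shift.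
by apply: eq_Rintegral => x _; rewrite iterSr.
Qed.

End shift_invariance.

(** The first [N + 1] terms are all at least [u N], so [u N <= S / (N + 1)]. *)
Lemma summable_nonincreasing_small (R : realType) (u : nat -> R) (S e : R) :
  (forall m, u m.+1 <= u m) -> (forall N, \sum_(k < N) u k <= S) -> 0 < e ->
  exists N, u N <= e.
Proof.
move=> u_nincr uS e0.
pose N := Num.truncn (S / e); have NS : S / e < N.+1%:R by exact: truncnS_gt.
exists N; have : N.+1%:R * u N <= S.
  apply: le_trans (uS N.+1); rewrite mulr_natl -[X in _ *+ X]card_ord.
  rewrite -sumr_const; apply: ler_sum => i _.
  have : (i <= N)%N by rewrite -ltnS.
  elim: {2 3}N => [|n IH]; first by rewrite leqn0 => /eqP ->.
  rewrite leq_eqVlt => /predU1P[->//|]; rewrite ltnS => /IH; exact: le_trans.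
move: NS; rewrite ltr_pdivrMr// => NS; have : 0 < (N.+1%:R : R) by [].
by move: NS; set K := N.+1%:R => *; nra.
Qed.

Section g_measures.
Context (A : pointedFinType) (R : realType) (psi : Omega A -> R).
Context (eta : nat -> R) (E : R).
Implicit Types (f : Omega A -> R) (x y : Omega A).

Hypothesis psi1 : forall x, \sum_(a : A) expR (psi (scons a x)) = 1.
Hypothesis psi_eta : forall m a x y, agree m x y ->
  `|psi (scons a x) - psi (scons a y)| <= eta m.
Hypothesis eta_nincr : forall m, eta m.+1 <= eta m.
Hypothesis sum_eta : forall N, \sum_(k < N) eta k <= E.

Local Notation gint := (gint psi).

Lemma g_function_ucont : ucont psi.
Proof.
move=> e e0; have [N etaN] := summable_nonincreasing_small eta_nincr sum_eta e0.
exists N.+1 => x y xy; rewrite -(scons_shift x) -(scons_shift y) xy//.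
apply: le_trans (psi_eta _ _) etaN; exact: agree_shift.
Qed.

Lemma g_function_le0 x : psi x <= 0.
Proof.
rewrite -ler_expR expR0 -(psi1 (shift x)) (bigD1 (x 0%N))//= scons_shift lerDl.
by rewrite sumr_ge0// => a _; exact: expR_ge0.
Qed.

(** The indicator of a cylinder is the sum of those of its one-letter refinements; additivity of
    [gint] thus gives the consistency that the coding requires. *)
Lemma g_measure_exists : exists mu : probability (Omega A) R,
  forall s, mu (cylinder s) = (gint \1_(cylinder s))%:E.
Proof.
have uc s := ucont_indic (R := R) (@cylindrical_cylinder A s).
apply: cylinder_measure_exists => [s||s].
- rewrite -(gint_cst psi1 psi_eta eta_nincr sum_eta 0).
  by apply: (le_gint psi1 psi_eta eta_nincr sum_eta) => //; exact: ucont_cst.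
- rewrite -(gint_cst psi1 psi_eta eta_nincr sum_eta 1); congr gint.
  by apply/funext => x; rewrite cylinder_nil indicE in_setT.
rewrite -(gint_sum psi1 psi_eta eta_nincr sum_eta) => [|a]; last exact: uc.
congr gint; apply/funext => x.
rewrite (bigD1 (x (size s)))//= big1 => [|a ax].
  rewrite addr0 !indicE; congr (_%:R); congr nat_of_bool.
  apply/idP/idP; rewrite !inE /cylinder /= size_rcons mkseqS;
    first by move=> ->.
  by move/rcons_inj => [].
rewrite indicE memNset// /cylinder /= size_rcons mkseqS => /rcons_inj[_ xa].
by rewrite xa eqxx in ax.
Qed.

Variable mu : probability (Omega A) R.
Hypothesis mu_gint : forall s, mu (cylinder s) = (gint \1_(cylinder s))%:E.

(** The step function [g] approximates [f] within [e / 2]. Both functionals are monotone and linear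
    and agree on [g], hence differ by at most [e] on [f]. *)
Lemma mean_gint f : ucont f -> \int[mu]_x f x = gint f.
Proof.
move=> uf; apply/eqP; rewrite -subr_eq0 -normr_le0; apply/ler_addgt0Pr => e e0.
have e2 : 0 < e / 2 by rewrite divr_gt0.
have [m fm] := uf _ e2.
pose F (t : m.-tuple A) x := f (prepend t point) * \1_(cylinder t) x.
have uF t : ucont (F t).
  exact/ucontZ/(ucont_indic (@cylindrical_cylinder A t)).
pose g x := \sum_t F t x.
have ug : ucont g by exact: ucont_sum.
have gE x : g x = f (prepend (mkseq x m) point).
  rewrite /g (bigD1 [tuple of mkseq x m])//= big1 => [|t tx].
    by rewrite addr0 /F indicE mem_set ?mulr1//= /cylinder/= size_mkseq.
  rewrite /F indicE memNset ?mulr0// /cylinder/= size_tuple => xt.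
  by move/eqP : tx; apply; apply: val_inj.
have fg x : `|f x - g x| <= e / 2.
  by rewrite gE distrC; apply: fm; exact: agree_prepend_mkseq.
have meang : \int[mu]_x g x = gint g.
  rewrite mean_sum => [|t]; last exact: ucont_bounded_measurable.
  rewrite (gint_sum psi1 psi_eta eta_nincr sum_eta)//; apply: eq_bigr => t _.
  rewrite meanZ; last exact: bounded_measurable_indic (measurable_cylinder t).
  rewrite mean_indic; last exact: measurable_cylinder.
  rewrite (gintZ psi1 psi_eta eta_nincr sum_eta);
    last exact: ucont_indic (@cylindrical_cylinder A t).
  by rewrite mu_gint.
have bg := ucont_bounded_measurable ug; have bf := ucont_bounded_measurable uf.
have c1 : ucont (fun x => g x + e / 2) by apply: ucontD => //; exact: ucont_cst.
have c2 : ucont (fun x => g x + - (e / 2)) by apply: ucontD => //;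
  exact: ucont_cst.
have h1 : \int[mu]_x f x <= \int[mu]_x (g x + e / 2).
  apply: le_mean => // [|x]; first exact: ucont_bounded_measurable.
  by have := fg x; rewrite ler_norml => /andP[]; lra.
have h2 : \int[mu]_x (g x + - (e / 2)) <= \int[mu]_x f x.
  apply: le_mean => // [|x]; first exact: ucont_bounded_measurable.
  by have := fg x; rewrite ler_norml => /andP[]; lra.
have gc c : gint (fun x => g x + c) = gint g + c.
  rewrite (gintD psi1 psi_eta eta_nincr sum_eta)//; last exact: ucont_cst.
  by rewrite (gint_cst psi1 psi_eta eta_nincr sum_eta).
have h3 : gint f <= gint (fun x => g x + e / 2).
  apply: (le_gint psi1 psi_eta eta_nincr sum_eta) => // x.
  by have := fg x; rewrite ler_norml => /andP[]; lra.
have h4 : gint (fun x => g x + - (e / 2)) <= gint f.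
  apply: (le_gint psi1 psi_eta eta_nincr sum_eta) => // x.
  by have := fg x; rewrite ler_norml => /andP[]; lra.
rewrite !gc in h3 h4.
move: h1 h2; rewrite !meanD// ?mean_cst ?meang => [h1 h2||];
  [|exact: bounded_measurable_cst..].
by rewrite add0r ler_norml; apply/andP; split; lra.
Qed.

Lemma g_measure_shift_invariant : shift_invariant mu.
Proof.
have ms s : measurable (@shift A @^-1` cylinder s).
  by rewrite -[X in measurable X]setTI; apply: (@measurable_shift A) => //;
    exact: measurable_cylinder.
suff h B : measurable B -> distribution mu (shift_mfun A) B = mu B by [].
apply: cylinder_measure_unique => s.
have e (C : set (Omega A)) : measurable C -> mu C = (\int[mu]_x \1_C x)%:E.
  by move=> mC; rewrite mean_indic// fineK//; exact: fin_num_measure.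
have uc := @ucont_indic A R _ _ (@cylindrical_cylinder A s).
rewrite -[LHS]/(mu (@shift A @^-1` cylinder s)) !e//;
  last exact: measurable_cylinder.
rewrite (mean_gint uc) -(gint_shift psi1 psi_eta eta_nincr sum_eta uc).
by rewrite -(mean_gint (ucont_shift uc)).
Qed.

End g_measures.

(** * The variational principle *)

Section cylindrical_labels.
Context (A : pointedFinType) (R : realType) (nu : probability (Omega A) R).
Context (k : nat) (P : Omega A -> 'I_k) (mP : finite_partition P).

Lemma measurable_label_neq m (Q : Omega A -> 'I_k) :
  (forall x y, agree m x y -> Q x = Q y) -> measurable [set x | P x <> Q x].
Proof.
move=> Qm; rewrite (_ : [set x | _] =
    \big[setU/set0]_(i < k) (P @^-1` [set i] `&` ~` (Q @^-1` [set i]))).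
  apply: bigsetU_measurable => i _; apply: measurableI; first exact: mP.
  apply: measurableC; apply: (@cylindrical_measurable _ m) => x y xy /= <-.
  exact/esym/Qm.
apply/seteqP; split => x.
  move=> /= PQ; rewrite -bigcup_seq; exists (P x);
    first by rewrite /= mem_index_enum.
  by split => //= QP; apply: PQ.
by rewrite -bigcup_seq => -[i _ /= [-> iQ]] /esym.
Qed.

Lemma cylindrical_label_approximation (e : R) : 0 < e ->
  exists m (Q : Omega A -> 'I_k), (forall x y, agree m x y -> Q x = Q y) /\
    fine (nu [set x | P x <> Q x]) <= e.
Proof.
move=> e0; have k0 : (0 < k)%N by case: (P point) => i; case: (k).
have ek : 0 < e / k%:R by rewrite divr_gt0// ltr0n.
have /choice[mC mCP] (i : 'I_k) : exists mC : nat * set (Omega A),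
    cylindrical mC.1 mC.2 /\
    (nu ((P @^-1` [set i] `\` mC.2) `|` (mC.2 `\` P @^-1` [set i])) <= (e /
      k%:R)%:E)%E.
  by have [m [C [mC hC]]] := approximable_measurable nu (mP i) ek;
    exists (m, C).
pose m := \max_i (mC i).1; pose C i := (mC i).2.
have CE i x y : agree m x y -> (x \in C i) = (y \in C i).
  move=> xy; have xyi : agree (mC i).1 x y.
    by apply: agree_le xy; exact: leq_bigmax.
  have [h _] := mCP i; apply/idP/idP; rewrite !inE; apply: h => //.
  exact: agree_sym.
(* [Q] picks a label whose approximating set contains [x]; off all symmetric differences it is
   [P x]. The default is a constant, so that [Q] depends on [m] letters only. *)
pose Q x : 'I_k := odflt (P point) [pick i | x \in C i].
have Qm x y : agree m x y -> Q x = Q y.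
  by move=> xy; rewrite /Q; congr odflt; apply: eq_pick => i; exact: CE.
exists m, Q; split => //.
pose sd i := (P @^-1` [set i] `\` C i) `|` (C i `\` P @^-1` [set i]).
have msd i : measurable (sd i).
  have mCi : measurable (C i) by have [/cylindrical_measurable] := mCP i.
  by apply: measurableU; apply: measurableD => //; exact: mP.
have bsd i := bounded_measurable_indic R (msd i).
have mPQ := measurable_label_neq Qm.
rewrite -(mean_indic nu mPQ).
apply: (@le_trans _ _ (\int[nu]_x (\sum_i \1_(sd i) x))).
  apply: le_mean; first exact: bounded_measurable_indic.
    exact: bounded_measurable_sum.
  move=> x; rewrite [leLHS]indicE; have [xPQ|_] := boolP (x \in _); last first.
    by rewrite sumr_ge0// => i _; rewrite indicE ler0n.
  have [i xi] : exists i, sd i x.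
    rewrite inE /= in xPQ; apply: contrapT => nsd.
    have CP i : (x \in C i) = (P x == i).
      apply/idP/eqP => [/set_mem Cix|Pxi]; apply: contrapT => nn; apply: nsd;
        exists i.
        by right.
      by left; split => // Cix; apply: nn; exact/mem_set.
    apply: xPQ; rewrite /Q; case: pickP => [i|/(_ (P x))]; rewrite CP;
      first by move/eqP.
    by rewrite eqxx.
  by rewrite (bigD1 i)//= indicE mem_set// lerDl sumr_ge0// => j _;
    rewrite indicE ler0n.
rewrite mean_sum//.
apply: (@le_trans _ _ (\sum_(i < k) e / k%:R)); last first.
  by rewrite sumr_const card_ord -(mulr_natr (e / k%:R)) divfK// pnatr_eq0
    -lt0n.
apply: ler_sum => i _; rewrite mean_indic//.
have nf : nu (sd i) \is a fin_num by exact: fin_num_measure.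
by have [_] := mCP i; rewrite -/(C i) -/(sd i) -[leLHS](fineK nf) lee_fin.
Qed.

End cylindrical_labels.

Lemma sum_prod_tuple_le1 (R : realType) k n (p : 'I_n -> 'I_k -> R) :
  (forall i j, 0 <= p i j) -> (forall i, \sum_j p i j <= 1) ->
  \sum_(w : n.-tuple 'I_k) \prod_(i < n) p i (tnth w i) <= 1.
Proof.
move=> p0 p1.
rewrite (reindex (fun g : {ffun 'I_n -> 'I_k} => [tuple g i | i < n])) /=;
  last first.
  exists (fun w : n.-tuple 'I_k => [ffun i => tnth w i]) => [g _|w _].
    by apply/ffunP => i; rewrite ffunE tnth_mktuple.
  by apply: eq_from_tnth => i; rewrite tnth_mktuple ffunE.
under eq_bigr do under eq_bigr do rewrite tnth_mktuple.
rewrite -(bigA_distr_bigA p).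
apply: (@le_trans _ _ (\prod_(i < n) 1)); last by rewrite big1.
apply: ler_prod => i _; rewrite p1 andbT; exact: sumr_ge0.
Qed.

Section entropy_of_g_measures.
Context (A : pointedFinType) (R : realType) (psi : Omega A -> R).
Context (eta : nat -> R) (E : R).
Implicit Types (f : Omega A -> R) (x y : Omega A).

Hypothesis psi1 : forall x, \sum_(a : A) expR (psi (scons a x)) = 1.
Hypothesis psi_eta : forall m a x y, agree m x y ->
  `|psi (scons a x) - psi (scons a y)| <= eta m.
Hypothesis eta_nincr : forall m, eta m.+1 <= eta m.
Hypothesis sum_eta : forall N, \sum_(k < N) eta k <= E.

Let psi_bm : bounded_measurable psi.
Proof. exact/ucont_bounded_measurable/(g_function_ucont psi_eta eta_nincr
  sum_eta). Qed.

Section upper_bound.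
Variable nu : probability (Omega A) R.
Hypothesis nu_inv : shift_invariant nu.
Variables (k : nat) (P : Omega A -> 'I_k).
Hypothesis mP : finite_partition P.

(* Gibbs' inequality compares nu with the law, under psi, of the itinerary of Q
   perturbed by independent noise of size delta. *)
Lemma join_entropy_le m (Q : Omega A -> 'I_k) delta n :
  (forall x y, agree m x y -> Q x = Q y) -> 0 < delta -> delta < 1 ->
  join_entropy nu (@shift A) P n <=
  E - (n + m)%:R * \int[nu]_x psi x - n%:R * ln (1 - delta)
  - n%:R * ln (delta / k%:R) * fine (nu [set x | P x <> Q x]).
Proof.
move=> Qm d0 d1; set B := [set x | P x <> Q x].
have mB : measurable B by exact: measurable_label_neq Qm.
have k0 : (0 < k)%N by case: (P point) => i; case: (k).
have k0' : 0 < k%:R :> R by rewrite ltr0n.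
have dk : 0 < delta / k%:R by rewrite divr_gt0.
have d1' : 0 < 1 - delta by rewrite subr_gt0.
(* The noise keeps a label with weight [1 - delta] and gives any other one weight [delta / k]. The
   total is at most 1, and no weight vanishes, as Gibbs' inequality requires. *)
pose kap (j i : 'I_k) : R := if i == j then 1 - delta else delta / k%:R.
have kap0 j i : 0 < kap j i by rewrite /kap; case: ifP.
have kap1 j : \sum_i kap j i <= 1.
  rewrite (bigD1 j)//= {1}/kap eqxx.
  have : \sum_(i | i != j) kap j i <= \sum_(i < k) delta / k%:R.
    rewrite [leLHS]big_mkcond; apply: ler_sum => i _.
    by rewrite /kap; case: eqP => //= _; exact: ltW.
  by rewrite sumr_const card_ord -(mulr_natr (delta / k%:R)) divfK ?gt_eqF//;
    lra.
(* The first [n] labels of [Q] are determined by the first [n + m] letters. *)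
pose N := (n + m)%N.
pose G (w : n.-tuple 'I_k) y :=
  \prod_(i < n) kap (Q (iter i (@shift A) y)) (tnth w i).
have G0 w y : 0 < G w y by apply: prodr_gt0.
pose q w := iter N (transfer psi) (G w) point.
have q_ge w s : size s = N ->
    expR (birkhoff_sum psi N (prepend s point)) * G w (prepend s point) <= q w.
  by move=> sN; rewrite /q -sN; apply: transfer_ge_branch => x; exact: ltW.
have q0 w : 0 < q w.
  apply: lt_le_trans (q_ge w (nseq N point) (size_nseq _ _)).
  by rewrite mulr_gt0// expR_gt0.
have q1 : \sum_w q w <= 1.
  rewrite -iter_transfer_sum; apply: iter_transfer_le => // y.
  by apply: (sum_prod_tuple_le1 (p := fun i =>
    kap (Q (iter i (@shift A) y)))) => // i j; exact: ltW.
have lnd : ln (1 - delta) <= 0 by rewrite ln_le0// gerBl ltW.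
have lndk : ln (delta / k%:R) <= 0.
  by rewrite ln_le0// ler_pdivrMr// mul1r (le_trans (ltW d1))// ler1n.
(* The single branch that follows [x] for [N] letters bounds [q] from below, up to the distortion
   [E]. Each visit of the first [n] iterates to [B] brings in the factor [delta / k]. *)
have q_lb x : birkhoff_sum psi N x - E + (n%:R * ln (1 - delta)
    + ln (delta / k%:R) * birkhoff_sum (\1_B) n x) <= ln (q (itinerary (@shift
      A) P n x)).
  set y := prepend (mkseq x N) point.
  have yx : agree N y x by exact: agree_prepend_mkseq.
  have h1 : birkhoff_sum psi N x - E <= birkhoff_sum psi N y.
    have := birkhoff_distortion psi_eta sum_eta (mkseq x N) point (iter N
      (@shift A) x).
    by rewrite size_mkseq prepend_mkseq -/y ler_norml => /andP[]; lra.
  have h2 : expR (n%:R * ln (1 - delta) + ln (delta / k%:R) * birkhoff_sum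
    (\1_B) n x)
      <= G (itinerary (@shift A) P n x) y.
    rewrite /birkhoff_sum big_mkord mulr_sumr.
    rewrite [X in X + _](_ : _ = \sum_(i < n) ln (1 - delta)); last first.
      by rewrite sumr_const card_ord mulr_natl.
    rewrite -big_split expR_sum; apply: ler_prod => i _; rewrite expR_ge0/=.
    rewrite tnth_mktuple (Qm (iter i (@shift A) y) (iter i (@shift A) x));
      last first.
      move=> j jm; rewrite !iter_shiftE; apply: yx.
      by rewrite /N -addnS leq_add// ltnW.
    rewrite /kap indicE; have [PQ|PQ] := eqVneq (P _) (Q _).
      by rewrite memNset ?mulr0 ?addr0 ?lnK ?posrE//; exact.
    rewrite mem_set; last by move/eqP: PQ.
    by rewrite mulr1 -[leRHS]lnK ?posrE// ler_expR gerDr.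
  rewrite -[leLHS]expRK; apply: ln_homo; first exact: expR_gt0.
  apply: le_trans (q_ge _ _ (size_mkseq x _)); rewrite expRD.
  by apply: ler_pM => //; rewrite ler_expR.
apply: (@le_trans _ _ (- \int[nu]_x ln (q (itinerary (@shift A) P n x)))).
  rewrite -(mean_itinerary nu (@measurable_shift A) mP (fun w => ln (q w))).
  apply: gibbs_inequality => //.
    by move=> w; exact: fine_ge0.
  exact: (sum_measure_join_cell nu (@measurable_shift A) mP).
have iB : bounded_measurable (\1_B : _ -> R) by exact: bounded_measurable_indic.
have b1 := bounded_measurable_birkhoff N psi_bm.
have b2 := bounded_measurable_birkhoff n iB.
have bc c : bounded_measurable (fun _ : Omega A =>
  c : R) := bounded_measurable_cst _ c.
have b3 := bounded_measurableD b1 (bc (- E)).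
have b4 := bounded_measurableD (bc (n%:R * ln (1 - delta)))
  (bounded_measurableZ (ln (delta / k%:R)) b2).
have := le_mean nu (bounded_measurableD b3 b4)
  (bounded_measurable_itinerary (@measurable_shift A) mP (fun w =>
    ln (q w))) q_lb.
rewrite (meanD nu b3 b4) (meanD nu b1 (bc _)) (meanD nu (bc _)
  (bounded_measurableZ _ b2)).
rewrite (meanZ nu _ b2) !mean_cst !mean_birkhoff// mean_indic//.
by rewrite -/N; lra.
Qed.

Lemma partition_entropy_le : partition_entropy nu (@shift A) P <= - \int[nu]_x
  psi x.
Proof.
set M := \int[nu]_x psi x.
have M0 : M <= 0.
  rewrite -(mean_cst nu 0); apply: le_mean => //;
    first exact: bounded_measurable_cst.
  exact: g_function_le0.
have [cv|dv] := pselect (cvgn (fun n =>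
  join_entropy nu (@shift A) P n / n%:R)); last first.
  (* the limit of a divergent sequence is the junk value [point], that is 0 *)
  rewrite /partition_entropy (dvgP dv); have -> : (point : R) = 0 by [].
  by rewrite oppr_ge0.
have E0 : 0 <= E by have := sum_eta 0; rewrite big_ord0.
apply/ler_addgt0Pr => e e0.
(* Per unit of time, [e / 4] is allotted to each of three errors: the noise, the disagreement of [P]
   with [Q], and the boundary terms. *)
pose delta := 1 - expR (- (e / 4)).
have d0 : 0 < delta by rewrite subr_gt0 expR_lt1 oppr_lt0 divr_gt0.
have d1 : delta < 1 by rewrite gtrBl expR_gt0.
have lnd : ln (1 - delta) = - (e / 4) by rewrite /delta opprB addrC subrK expRK.
pose b := - ln (delta / k%:R).
have k0 : (0 < k)%N by case: (P point) => i; case: (k).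
have b0 : 0 <= b.
  rewrite oppr_ge0 ln_le0// ler_pdivrMr ?ltr0n// mul1r (le_trans (ltW d1))//
    ler1n//.
have eb : 0 < e / 4 / (b + 1) by rewrite !divr_gt0// ltr_wpDl.
have [m [Q [Qm hQ]]] := cylindrical_label_approximation nu mP eb.
apply: limr_le => //.
(* From [n0] on, [E] and the [m] surplus terms of the Birkhoff sum cost at most [e / 4] per unit of
   time. *)
pose n0 := (Num.truncn ((E - m%:R * M) / (e / 4))).+1.
exists n0 => // n /= n0n.
have n_gt0 : 0 < n%:R :> R by rewrite ltr0n; exact: leq_trans n0n.
rewrite ler_pdivrMr//; apply: le_trans (join_entropy_le n Qm d0 d1) _.
rewrite -/M lnd natrD.
have hb : b * fine (nu [set x | P x <> Q x]) <= e / 4.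
  move: hQ; rewrite ler_pdivlMr ?ltr_wpDl// => hQ.
  have : 0 <= fine (nu [set x | P x <> Q x]) by exact: fine_ge0.
  set F := fine _ in hQ *; lra.
have hn : E - m%:R * M <= n%:R * (e / 4).
  rewrite -ler_pdivrMr ?divr_gt0//; apply: (@le_trans _ _ n0%:R).
    by apply/ltW; exact: truncnS_gt.
  by rewrite ler_nat.
have -> : n%:R * ln (delta / k%:R) * fine (nu [set x | P x <> Q x]) =
  - (n%:R * (b * fine (nu [set x | P x <> Q x]))) by rewrite /b; ring.
set F := b * fine _ in hb *.
have : n%:R * F <= n%:R * (e / 4) by rewrite ler_wpM2l// ltW.
have : 0 <= n%:R * e by rewrite mulr_ge0// ltW.
lra.
Qed.

End upper_bound.

Lemma ks_entropy_le nu : shift_invariant nu ->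
  (ks_entropy nu (@shift A) <= (- \int[nu]_x psi x)%:E)%E.
Proof.
move=> inv; apply: ge_ereal_sup => _ [k [P [mP ->]]].
by rewrite lee_fin; exact: partition_entropy_le.
Qed.

Variable mu : probability (Omega A) R.
Hypothesis mu_gint : forall s, mu (cylinder s) = (gint psi \1_(cylinder s))%:E.

Let mu_inv : shift_invariant mu.
Proof. exact: (g_measure_shift_invariant psi1 psi_eta eta_nincr sum_eta
  mu_gint). Qed.

(** The Gibbs property: on the indicator of the cylinder the iterate of order [size s] has one
    branch left, and its weight varies by a factor of at most [expR E]. *)
Lemma g_measure_cylinder s x : cylinder s x ->
  expR (birkhoff_sum psi (size s) x - E) <= fine (mu (cylinder s)) <=
  expR (birkhoff_sum psi (size s) x + E).
Proof.
move=> sx; have uc := @ucont_indic A R _ _ (@cylindrical_cylinder A s).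
have xE : prepend s (iter (size s) (@shift A) x) = x.
  by rewrite -{1}sx prepend_mkseq.
have h y : iter (size s) (transfer psi) \1_(cylinder s) y =
    expR (birkhoff_sum psi (size s) (prepend s y)).
  rewrite -[RHS]mulr1 -(iter_transfer_cylinder psi s (fun=> 1)).
  by congr (iter _ _ _ _); apply/funext => z; rewrite mulr1.
have dist y : `|birkhoff_sum psi (size s) (prepend s y) - birkhoff_sum psi
  (size s) x| <= E.
  by rewrite -xE; exact: (birkhoff_distortion psi_eta sum_eta).
rewrite mu_gint /=; apply/andP; split.
  apply: (gint_iter_transfer psi1 psi_eta eta_nincr sum_eta (k := size s)) =>
    // y.
  by rewrite h ler_expR; have := dist y; rewrite ler_norml => /andP[]; lra.
apply: (gint_iter_transfer_le psi1 psi_eta eta_nincr sum_eta (k := size s)) =>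
  // y.
by rewrite h ler_expR; have := dist y; rewrite ler_norml => /andP[]; lra.
Qed.

(** The generating partition, whose joins are the cylinders. *)
Let letter (x : Omega A) : 'I_#|A| := enum_rank (x 0%N).

Let m_letter : finite_partition letter.
Proof.
move=> i; apply: (@cylindrical_measurable _ 1) => x y xy /=.
by rewrite /letter => <-; rewrite xy.
Qed.

Let join_cell_letter n (w : n.-tuple 'I_#|A|) :
  join_cell (@shift A) letter w = cylinder (map enum_val w).
Proof.
apply/seteqP; split => x.
  move=> xw; rewrite /cylinder/= size_map size_tuple.
  apply: (@eq_from_nth _ point); first
    by rewrite size_mkseq size_map size_tuple.
  rewrite size_mkseq => i iltn; rewrite nth_mkseq//.
  have iw : (i < size w)%N by rewrite size_tuple.
  rewrite (nth_map (letter x))//.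
  have := xw (Ordinal iltn); rewrite /letter (tnth_nth (letter x)) /= => <-.
  by rewrite enum_rankK iter_shiftE addn0.
rewrite /cylinder /= size_map size_tuple => xw i.
rewrite /letter iter_shiftE addn0 (tnth_nth (letter x)).
have -> : x i = nth point (mkseq x n) i by rewrite nth_mkseq.
by rewrite xw (nth_map (letter x)) ?size_tuple// enum_valK.
Qed.

Lemma join_entropy_letter n :
  `|join_entropy mu (@shift A) letter n + n%:R * \int[mu]_x psi x| <= E.
Proof.
pose c (w : n.-tuple 'I_#|A|) := ln (fine (mu (join_cell (@shift A) letter w))).
have cx x : birkhoff_sum psi n x + - E <= c (itinerary (@shift A) letter n x)
  <= birkhoff_sum psi n x + E.
  set w := itinerary _ _ _ _.
  have xw : cylinder (map enum_val w) x.
    by rewrite -join_cell_letter; exact/join_cellE.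
  have := g_measure_cylinder xw; rewrite /c join_cell_letter size_map
    size_tuple.
  move=> /andP[h1 h2].
  have := ln_homo (expR_gt0 _) h1; have := ln_homo (lt_le_trans (expR_gt0 _)
    h1) h2.
  by rewrite !expRK => -> ->.
have bc e : bounded_measurable (fun _ : Omega A =>
  e : R) := bounded_measurable_cst _ e.
have b1 := bounded_measurable_birkhoff n psi_bm.
have b2 := bounded_measurable_itinerary (@measurable_shift A) m_letter c.
have -> : join_entropy mu (@shift A) letter n = - \int[mu]_x c (itinerary
  (@shift A) letter n x).
  by rewrite -(mean_itinerary mu (@measurable_shift A) m_letter).
have := le_mean mu (bounded_measurableD b1 (bc (- E))) b2 (fun x =>
  proj1 (andP (cx x))).
have := le_mean mu b2 (bounded_measurableD b1 (bc E)) (fun x =>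
  proj2 (andP (cx x))).
rewrite !(meanD mu b1 (bc _)) !mean_cst !(mean_birkhoff _ mu_inv)//.
by rewrite ler_norml => *; apply/andP; split; lra.
Qed.

(** The general upper bound is attained by the partition into first letters: its [n]-th join entropy
    differs from [n] times the bound by at most [E]. *)
Lemma ks_entropy_g_measure : ks_entropy mu (@shift A) = (- \int[mu]_x psi x)%:E.
Proof.
apply/eqP; rewrite eq_le ks_entropy_le//=; apply: ereal_sup_ubound.
exists #|A|, letter; split => //; congr EFin; apply/esym/cvg_lim => //.
set M := \int[mu]_x psi x.
have E0 : 0 <= E by have := sum_eta 0; rewrite big_ord0.
apply/cvgrPdist_le => e e0.
exists (Num.truncn (E / e)).+1 => // n /= hn.
have n0 : 0 < n%:R :> R by rewrite ltr0n; exact: leq_trans hn.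
have En : E <= e * n%:R.
  rewrite mulrC -ler_pdivrMr//; apply: (@le_trans _ _ (Num.truncn (E /
    e)).+1%:R).
    by apply/ltW; exact: truncnS_gt.
  by rewrite ler_nat.
have -> : - M - join_entropy mu (@shift A) letter n / n%:R =
   - ((join_entropy mu (@shift A) letter n + n%:R * M) / n%:R).
  by field; rewrite gt_eqF.
rewrite normrN normrM normfV (gtr0_norm n0) ler_pdivrMr//.
exact: le_trans (join_entropy_letter n) En.
Qed.

End entropy_of_g_measures.

(** * Concentration *)

(** For [y <= 1/2], [expR y <= 1 / (1 - y) <= 1 + y + 2 * y ^+ 2]; beyond, [y <= 2 * y ^+ 2]. *)
Lemma expR_le_add_sqr (R : realType) (y : R) : expR y <= y + expR (2 * y ^+ 2).
Proof.
have [y2|y2] := leP y (2^-1).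
  have h1 : 0 < 1 - y by lra.
  have e1 : expR y * (1 - y) <= 1.
    have := expR_ge1Dx (- y); rewrite expRN => h; have y0 := expR_gt0 y.
    have := ler_wpM2l (expR_ge0 y) h.
    by rewrite mulfV ?gt_eqF.
  have := expR_ge1Dx (2 * y ^+ 2) => h2.
  have : expR y <= 1 + y + 2 * y ^+ 2.
    rewrite -(ler_pM2r h1); apply: le_trans e1 _.
    have : 0 <= y ^+ 2 * (1 - 2 * y) by rewrite mulr_ge0 ?sqr_ge0//; lra.
    nra.
  lra.
have : expR y <= expR (2 * y ^+ 2) by rewrite ler_expR; nra.
lra.
Qed.

(** A bound of Hoeffding type: once [u] is centred, the linear term of [expR_le_add_sqr] averages to
    0. *)
Lemma exponential_mean_le (R : realType) (I : finType) (p u : I -> R) (B : R) :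
  (forall i, 0 <= p i) -> \sum_i p i = 1 ->
  (forall i j, `|u i - u j| <= B) ->
  \sum_i p i * expR (u i) <= expR (2 * B ^+ 2) * expR (\sum_i p i * u i).
Proof.
move=> p0 p1 uB; pose v := \sum_i p i * u i.
have uv i : `|u i - v| <= B.
  have -> : u i - v = \sum_j p j * (u i - u j).
    under [RHS]eq_bigr do rewrite mulrBr.
    by rewrite sumrB -mulr_suml p1 mul1r.
  apply: le_trans (ler_norm_sum _ _ _) _; rewrite -[leRHS]mul1r -p1 mulr_suml.
  by apply: ler_sum => j _; rewrite normrM ger0_norm// ler_wpM2l.
have h i : expR (u i - v) <= (u i - v) + expR (2 * B ^+ 2).
  apply: le_trans (expR_le_add_sqr _) _; rewrite lerD2l ler_expR ler_wpM2l//.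
  by rewrite -real_normK ?num_real// lerXn2r ?nnegrE// (le_trans _ (uv i)).
have : \sum_i p i * expR (u i - v) <= \sum_i p i * ((u i - v) + expR (2 * B ^+
  2)).
  by apply: ler_sum => i _; rewrite ler_wpM2l.
have -> : \sum_i p i * ((u i - v) + expR (2 * B ^+ 2)) = expR (2 * B ^+ 2).
  under eq_bigr do rewrite mulrDr mulrBr.
  by rewrite big_split sumrB /= -!mulr_suml p1 !mul1r subrr add0r.
have -> : \sum_i p i * expR (u i - v) = (\sum_i p i * expR (u i)) * expR (- v).
  by rewrite mulr_suml; apply: eq_bigr => i _; rewrite expRD mulrA.
by rewrite expRN ler_pdivrMr ?expR_gt0.
Qed.

Section convolution.
Context (R : realType) (d : nat -> R) (D : R).
Hypotheses (d0 : forall i, 0 <= d i) (dD : forall N, \sum_(i < N) d i <= D).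

Let lag j k : R := if (j <= k)%N then d (k - j)%N else 0.

Let lag0 j k : 0 <= lag j k. Proof. by rewrite /lag; case: ifP. Qed.

Let sum_lag_future N j : \sum_(k < N) lag j k <= D.
Proof.
suff -> : \sum_(k < N) lag j k = \sum_(i < N - j) d i by exact: dD.
elim: N => [|N IH]; first by rewrite !big_ord0.
rewrite big_ord_recr IH /= /lag; case: leqP => jN;
  first by rewrite subSn// big_ord_recr.
by rewrite addr0; have -> : (N - j = N.+1 - j)%N by apply/eqP;
  rewrite (eqP jN) subn_eq0 ltnW.
Qed.

Let sum_lag_past n k : \sum_(j < n) lag j k <= D.
Proof.
(* The terms missing from the full sum are the [d i] with [i <= k - n]; truncated subtraction leaves
   none when [n > k]. *)
suff : \sum_(j < n) lag j k + \sum_(i < k.+1 - n) d i = \sum_(i < k.+1) d i.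
  have := dD k.+1; have : 0 <= \sum_(i < k.+1 - n) d i by exact: sumr_ge0.
  lra.
elim: n => [|n IH]; first by rewrite big_ord0 add0r subn0.
rewrite -{}IH big_ord_recr /= -addrA; congr (_ + _); rewrite /lag;
  case: leqP => nk.
  by rewrite subSS subSn// big_ord_recr addrC.
have -> : (k.+1 - n.+1 = 0)%N by apply/eqP; rewrite subn_eq0 ltnW.
have -> : (k.+1 - n = 0)%N by apply/eqP; rewrite subn_eq0.
by rewrite big_ord0 addr0.
Qed.

(* Young's inequality l1 * l2 -> l2 *)
Lemma sum_sqr_convolution n N (L : 'I_n -> R) :
  \sum_(k < N) (\sum_(j < n) L j * (if (j <= k)%N then d (k - j)%N else 0)) ^+ 2
  <= D ^+ 2 * \sum_(j < n) L j ^+ 2.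
Proof.
have D0 : 0 <= D by have := dD 0; rewrite big_ord0.
(* The Cauchy-Schwarz inequality for the weights [lag j k], by expanding the square and
   symmetrizing. *)
have step k : (\sum_(j < n) L j * lag j k) ^+ 2 <= D * \sum_(j < n) L j ^+ 2 *
  lag j k.
  pose S := \sum_(i < n) lag i k.
  have -> : (\sum_(j < n) L j * lag j k) ^+ 2 =
      \sum_(i < n) \sum_(j < n) (L i * lag i k) * (L j * lag j k).
    by rewrite expr2 mulr_suml; apply: eq_bigr => i _; rewrite mulr_sumr.
  apply: (@le_trans _ _ (\sum_(i < n) \sum_(j < n)
      (2^-1 * (L i ^+ 2 * lag i k * lag j k) + 2^-1 * (L j ^+ 2 * lag j k * lag
        i k)))).
    apply: ler_sum => i _; apply: ler_sum => j _.
    have : 0 <= (L i - L j) ^+ 2 * (lag i k * lag j k)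
      by rewrite mulr_ge0 ?sqr_ge0// mulr_ge0.
    nra.
  have -> : \sum_(i < n) \sum_(j < n)
      (2^-1 * (L i ^+ 2 * lag i k * lag j k) + 2^-1 * (L j ^+ 2 * lag j k * lag
        i k)) =
      S * \sum_(j < n) L j ^+ 2 * lag j k.
    under eq_bigr do rewrite big_split.
    rewrite big_split /= [X in _ + X]exchange_big /=.
    under eq_bigr do rewrite -mulr_sumr -mulr_sumr -/S.
    by rewrite -mulr_sumr -mulr_suml; lra.
  apply: ler_wpM2r; last exact: sum_lag_past.
  by rewrite sumr_ge0// => j _; rewrite mulr_ge0// sqr_ge0.
apply: (@le_trans _ _ (\sum_(k < N) D * \sum_(j < n) L j ^+ 2 * lag j k)).
  by apply: ler_sum => k _; exact: step.
rewrite -mulr_sumr exchange_big expr2 -mulrA ler_wpM2l// mulr_sumr.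
apply: ler_sum => j _; by rewrite -mulr_sumr mulrC ler_wpM2r ?sqr_ge0.
Qed.

End convolution.

(** * Lipschitz constants and changes of several coordinates *)

Section distances.
Context (A : pointedFinType) (R : realType) (theta : R).
Hypotheses (theta_gt0 : 0 < theta) (theta_lt1 : theta < 1).
Implicit Types (x y : Omega A).

Lemma dist_ge0 x y : 0 <= dist theta x y.
Proof. by rewrite /dist; case: pselect => // h; rewrite exprn_ge0// ltW. Qed.

Lemma dist_le m x y : agree m x y -> dist theta x y <= theta ^+ m.
Proof.
move=> xy; rewrite /dist; case: pselect => [h|_];
  last by rewrite exprn_ge0// ltW.
case: ex_minnP => i xyi _; apply: ler_wiXn2l; [exact: ltW|exact: ltW|].
by rewrite leqNgt; apply/negP => /xy e; rewrite e eqxx in xyi.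
Qed.

Lemma dist_refl x : dist theta x x = 0.
Proof. by rewrite /dist; case: pselect => // h; exfalso; case: h => k /eqP. Qed.

Section lipschitz.
Context (n : nat) (K : ('I_n -> Omega A) -> R).
Hypothesis K_lip : separately_lipschitz theta K.

Lemma Lip_ge0 i : 0 <= Lip theta K i.
Proof. by apply: lb_le_inf => [|L []]; first exact: K_lip. Qed.

(** The conditions on a Lipschitz constant are closed, so the infimum satisfies them; at distance 0
    any admissible constant already forces [K x = K y]. *)
Lemma Lip_attained i (x y : 'I_n -> Omega A) : (forall j, j != i -> x j = y j)
  ->
  `|K x - K y| <= Lip theta K i * dist theta (x i) (y i).
Proof.
move=> xy; have := dist_ge0 (x i) (y i);
  rewrite le_eqVlt => /predU1P[dxy0|d_gt0].
  have [L [_ /(_ x y xy)]] := K_lip i.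
  by rewrite -dxy0 !mulr0.
rewrite -ler_pdivrMr//; apply: lb_le_inf; first exact: K_lip.
by move=> L [_ /(_ x y xy)]; rewrite ler_pdivrMr.
Qed.

(** The coordinates are exchanged one at a time; [z k] takes its first [k] coordinates from [y]. *)
Lemma Lip_sum (x y : 'I_n -> Omega A) :
  `|K x - K y| <= \sum_(i < n) Lip theta K i * dist theta (x i) (y i).
Proof.
pose z k (i : 'I_n) := if (i < k)%N then y i else x i.
suff h k : (k <= n)%N -> `|K x - K (z k)| <=
    \sum_(i < n | (i < k)%N) Lip theta K i * dist theta (x i) (y i).
  have := h n (leqnn n); have -> : z n = y by apply/funext => i;
    rewrite /z ltn_ord.
  by congr (_ <= _); apply: eq_bigl => i; rewrite ltn_ord.
elim: k => [|k IH] kn.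
  have -> : z 0%N = x by exact/funext.
  by rewrite subrr normr0 big_pred0.
pose i0 := Ordinal kn.
rewrite (bigD1 i0)//= addrC.
have -> : K x - K (z k.+1) = (K x - K (z k)) + (K (z k) - K (z k.+1)).
  by rewrite addrA subrK.
apply: le_trans (ler_normD _ _) _; apply: lerD.
  apply: le_trans (IH (ltnW kn)) _.
  rewrite le_eqVlt; apply/orP; left; apply/eqP; apply: eq_bigl => i.
  by rewrite ltnS [in RHS]leq_eqVlt -(inj_eq val_inj) /=; case: ltngtP.
have -> : x i0 = z k i0 by rewrite /z /= ltnn.
have -> : y i0 = z k.+1 i0 by rewrite /z /= ltnSn.
apply: Lip_attained.
move=> j; rewrite -(inj_eq val_inj) /= => jk;
  rewrite /z ltnS [(j <= k)%N]leq_eqVlt.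
by rewrite (negbTE jk).
Qed.

End lipschitz.
End distances.

Section concentration.
Context (A : pointedFinType) (R : realType) (psi : Omega A -> R).
Context (eta : nat -> R) (E theta : R).
Implicit Types (x y : Omega A).

Hypothesis psi1 : forall x, \sum_(a : A) expR (psi (scons a x)) = 1.
Hypothesis psi_eta : forall m a x y, agree m x y ->
  `|psi (scons a x) - psi (scons a y)| <= eta m.
Hypothesis eta_nincr : forall m, eta m.+1 <= eta m.
Hypothesis sum_eta : forall N, \sum_(k < N) eta k <= E.
Hypotheses (theta_gt0 : 0 < theta) (theta_lt1 : theta < 1).

Let eta_ge0 := modulus_ge0 psi_eta.
Let delta k m := iter k (house eta) (fun m => theta ^+ m) m.
Let D := house_bound E theta.

Let theta_nincr m : theta ^+ m.+1 <= theta ^+ m.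
Proof. by rewrite exprS ler_piMl ?exprn_ge0 ?ltW. Qed.

Let delta_ge0 k m : 0 <= delta k m.
Proof. by apply: iter_house_ge0 => // j; rewrite exprn_ge0// ltW. Qed.

Section orbit_lipschitz.
Context (n : nat) (L : 'I_n -> R) (F : Omega A -> R).
Hypothesis L_ge0 : forall j, 0 <= L j.
Hypothesis F_lip : forall x y, `|F x - F y| <=
  \sum_(j < n) L j * dist theta (iter j (@shift A) x) (iter j (@shift A) y).

Lemma orbit_lipschitz_ucont : ucont F.
Proof.
move=> e e0; pose S := \sum_(j < n) L j; have S0 : 0 <= S by exact: sumr_ge0.
have eS : 0 < e / (S + 1) by rewrite divr_gt0// ltr_wpDl.
have t1 : `|theta| < 1 by rewrite gtr0_norm.
have /cvgrPdist_le/(_ _ eS)[p _ /(_ p (leqnn p))] := cvg_expr t1.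
rewrite /= sub0r normrN => /(le_trans (ler_norm _)) tp.
exists (n + p)%N => x y xy; apply: le_trans (F_lip x y) _.
apply: (@le_trans _ _ (\sum_(j < n) L j * (e / (S + 1)))).
  apply: ler_sum => j _; rewrite ler_wpM2l// (le_trans _ tp)//.
  apply: dist_le => // i ip; rewrite !iter_shiftE; apply: xy.
  by rewrite -addnS leq_add// ltnW.
rewrite -mulr_suml -/S mulrCA ler_piMr ?(ltW e0)// ler_pdivrMr ?ltr_wpDl//.
by rewrite mul1r lerDl.
Qed.

(* [x] and [y] agreeing up to [m] are pulled back by the coupling; the
   coordinate [j] is reached after [j] steps and then contracted. *)
Let cost k m x y := \sum_(j < n) L j * (if (j <= k)%N then delta (k - j) m
  else dist theta (iter (j - k) (@shift A) x) (iter (j - k) (@shift A) y)).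

Lemma iter_transfer_orbit_lipschitz k m x y : agree m x y ->
  `|iter k (transfer psi) F x - iter k (transfer psi) F y| <= cost k m x y.
Proof.
elim: k m x y => [|k IH] m x y xy.
  apply: le_trans (F_lip x y) _; apply: ler_sum => j _; rewrite ler_wpM2l//.
  by case: j => -[|j] jn //=; exact: dist_le.
(* [e] collects the coordinates already reached, whose cost follows the chain; [c] the later ones,
   whose cost does not depend on the letters chosen, since the shift removes them. *)
pose e m := \sum_(j < n) L j * (if (j <= k)%N then delta (k - j) m else 0).
pose c := \sum_(j < n) L j * (if (j <= k)%N then 0 else
  dist theta (iter (j - k.+1) (@shift A) x) (iter (j - k.+1) (@shift A) y)).
have costE m' a b : cost k m' (scons a x) (scons b y) = c + e m'.
  rewrite /cost /c /e -big_split; apply: eq_bigr => j _ /=; rewrite -mulrDr.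
  congr (_ * _); case: leqP => jk; first by rewrite add0r.
  by rewrite addr0 -[in LHS](subnSK jk) !iterSr !shift_scons.
have eL m' : e m'.+1 <= e m'.
  apply: ler_sum => j _; rewrite ler_wpM2l//; case: ifP => // _.
  exact: iter_house_nonincreasing.
have e0 m' : e m' <= e 0%N by elim: m' => // m'; exact: le_trans.
apply: (@le_trans _ _ (c + house eta e m)).
  rewrite !iterS; apply: transfer_coupling => //.
  - by move=> a; exact: psi_eta.
  - by move=> a; rewrite -(costE _ a a); apply: IH; exact: agree_scons.
  - by move=> a b; rewrite -(costE _ a b); exact: IH.
rewrite /e (house_sum eta _ _ (fun j m =>
  L j * (if (j <= k)%N then delta (k - j) m else 0))).
rewrite /c /cost -big_split; apply: ler_sum => j _ /=.
rewrite houseZ -mulrDr ler_wpM2l//; case: (ltngtP j k.+1) => jk.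
- by rewrite -ltnS jk add0r subSn// -ltnS.
- by rewrite leqNgt (ltnW jk)/= /house !mulr0 !addr0.
(* The coordinate reached at this very step: its distance is now bounded by [theta ^+ m]. *)
rewrite jk ltnn subnn /house !mulr0 !addr0; exact: dist_le.
Qed.

Let osc k := \sum_(j < n) L j * (if (j <= k)%N then delta (k - j) 0 else 0).

(** Coordinates [j > k] are seen after at least one shift, which removes the first letter, so they
    contribute nothing. *)
Let iter_transfer_osc k a b z :
  `|iter k (transfer psi) F (scons a z) - iter k (transfer psi) F (scons b z)|
    <= osc k.
Proof.
apply: le_trans (iter_transfer_orbit_lipschitz k (@agree0 _ (scons a z) (scons
  b z))) _.
apply: ler_sum => j _; rewrite ler_wpM2l//; case: leqP => // jk.
by rewrite -(subnSK jk) !iterSr !shift_scons dist_refl.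
Qed.

Lemma iter_transfer_expR N x : iter N (transfer psi) (fun y => expR (F y)) x <=
  expR (\sum_(k < N) 2 * osc k ^+ 2) * expR (iter N (transfer psi) F x).
Proof.
elim: N x => [|N IH] x; first by rewrite big_ord0 expR0 mul1r.
rewrite iterS; apply: le_trans (le_transfer psi IH x) _.
rewrite transferZ big_ord_recr expRD -mulrA ler_wpM2l ?expR_ge0//.
rewrite iterS /transfer; exact: exponential_mean_le.
Qed.

Lemma gint_expR_le : gint psi (fun x => expR (F x)) <=
  expR (2 * D ^+ 2 * \sum_(j < n) L j ^+ 2) * expR (gint psi F).
Proof.
have uF := orbit_lipschitz_ucont.
have c1 := gint_cvg psi1 psi_eta eta_nincr sum_eta point (ucont_expR uF).
have c2 := gint_cvg psi1 psi_eta eta_nincr sum_eta point uF.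
have c3 : expR (2 * D ^+ 2 * \sum_(j < n) L j ^+ 2) *
    expR (iter N (transfer psi) F point) @[N --> \oo] -->
    expR (2 * D ^+ 2 * \sum_(j < n) L j ^+ 2) * expR (gint psi F).
  apply: cvgMl_tmp; apply: (continuous_cvg _ _ c2); exact: continuous_expR.
apply: ler_cvg_to c1 c3 _; apply: nearW => N.
apply: le_trans (iter_transfer_expR N point) _.
rewrite ler_wpM2r ?expR_ge0// ler_expR -mulr_sumr -mulrA ler_wpM2l//.
(* The bound does not depend on [N], since [D] bounds the sum over all times of the chain started at
   0. *)
apply: (@sum_sqr_convolution R (delta^~ 0%N) D) => [i|M];
  first exact: delta_ge0.
exact: (sum_iter_house_exp eta_ge0 sum_eta theta_gt0 theta_lt1).
Qed.

End orbit_lipschitz.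
End concentration.

(** * Rates of decay *)

Section decay_rates.
Context (R : realType).
Implicit Types (u : nat -> R) (alpha c : R).

Lemma powRnE (n : nat) (p : R) : (0 < n)%N -> n%:R `^ p = expR (p * ln n%:R) :>
  R.
Proof. by case: n => // n _; rewrite /powR pnatr_eq0. Qed.

Lemma near_ln_ge (T : R) : \forall n \near \oo, T <= ln (n%:R : R).
Proof.
have := @nbhs_infty_ger R (expR T); apply: filterS => n Tn.
by rewrite -[leLHS]expRK; apply: ln_homo => //; exact: expR_gt0.
Qed.

(** The comparison of series and integral, on the logarithmic scale: it follows from
    [ln (n + 1) - ln n >= 1 / (n + 1)] and [1 + t <= expR t]. *)
Lemma power_le_telescope (n : nat) alpha : (0 < n)%N -> 1 < alpha ->
  (alpha - 1) * n.+1%:R `^ (- alpha) <=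
    n%:R `^ (- (alpha - 1)) - n.+1%:R `^ (- (alpha - 1)).
Proof.
move=> n0 a1; rewrite !powRnE//; set s := alpha - 1.
have s0 : 0 < s by rewrite subr_gt0.
have n0' : 0 < n%:R :> R by rewrite ltr0n.
have nS : n.+1%:R = n%:R + 1 :> R by rewrite natr1.
set a := ln n%:R; set b := ln n.+1%:R.
have ab : n.+1%:R^-1 <= b - a.
  have : ln (1 + - n.+1%:R^-1) <= - n.+1%:R^-1 :> R.
    by rewrite le_ln1Dx// ltrN2 invf_lt1// ltr1n ltnS.
  have -> : 1 + - n.+1%:R^-1 = n%:R / n.+1%:R :> R.
    by rewrite nS; field; rewrite gt_eqF// ltr_wpDr.
  rewrite ln_div ?posrE ?ltr0n// -/a -/b; move: (n.+1%:R^-1 : R) => i; lra.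
have -> : expR (- alpha * b) = expR (- s * b) * n.+1%:R^-1.
  have -> : - alpha * b = - s * b + - b by rewrite /s; ring.
  by rewrite expRD [expR (- b)]expRN lnK ?posrE.
have -> : expR (- s * a) = expR (- s * b) * expR (s * (b - a)).
  by rewrite -expRD; congr expR; ring.
have := expR_ge1Dx (s * (b - a)); have := expR_gt0 (- s * b).
set X := expR (- s * b); set Y := expR (s * (b - a));
  set i := n.+1%:R^-1 in ab *.
move=> X0 hY; have h1 : s * i <= s * (b - a) by rewrite ler_pM2l.
have : X * (1 + s * i) <= X * Y by rewrite ler_pM2l//; lra.
nra.
Qed.

Lemma power_decay_summable u alpha c : (forall n, 0 <= u n) -> 1 < alpha ->
  (\forall n \near \oo, u n <= c * n%:R `^ (- alpha)) ->
  exists S : R, forall N, \sum_(k < N) u k <= S.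
Proof.
move=> u0 a1 [N0 _ uN].
have s0 : 0 < alpha - 1 by rewrite subr_gt0.
pose t n := n%:R `^ (- (alpha - 1)) : R.
pose C := `|c| / (alpha - 1); have C0 : 0 <= C by rewrite divr_ge0// ltW.
pose M := \sum_(k < N0.+2) u k.
have key p : \sum_(k < N0.+2 + p) u k <= M + C * (t N0.+1 - t (N0.+1 + p)%N).
  elim: p => [|p IH]; first by rewrite !addn0 subrr mulr0 addr0.
  rewrite !addnS big_ord_recr /=.
  have h1 : u (N0.+2 + p)%N <= C * (t (N0.+1 + p)%N - t (N0.+1 + p).+1).
    apply: le_trans (uN _ _) _; first
      by rewrite /= (leq_trans (leq_addr p N0))// !addSn ltnW.
    have := @power_le_telescope (N0.+1 + p) alpha isT a1.
    rewrite -/(t _) -/(t _) addSn => h.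
    have h2 : `|c| * (N0.+1 + p).+1%:R `^ (- alpha) <=
        C * (t (N0.+1 + p)%N - t (N0.+1 + p).+1).
      by rewrite /C mulrAC ler_pdivlMr// -mulrA ler_wpM2l// mulrC.
    by apply: le_trans h2; rewrite ler_wpM2r ?powR_ge0// ler_norm.
  by move: IH h1; lra.
exists (M + C * t N0.+1) => N.
apply: (@le_trans _ _ (\sum_(k < N0.+2 + N) u k)).
  rewrite addnC big_split_ord /= lerDl sumr_ge0//.
apply: le_trans (key N) _; rewrite lerD2l ler_wpM2l// lerBlDr lerDl.
exact: powR_ge0.
Qed.

Lemma eqO_power_decay u (g : nat -> R) alpha :
  u =O_\oo g ->
  (\forall n \near \oo, `|g n| <= n%:R `^ (- alpha)) ->
  exists c : R, \forall n \near \oo, u n <= c * n%:R `^ (- alpha).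
Proof.
move=> /eqO_exP[c c0 uc] gn; exists c; near=> n.
apply: le_trans (ler_norm _) _.
apply: le_trans (_ : c * `|g n| <= _); first by near: n.
by rewrite ler_pM2l//; near: n.
Unshelve. all: by end_near. Qed.

(** By [expR u >= 1 + u ^+ 2 / 2] at [u = alpha * ln n], the exponent grows at least quadratically
    in [ln n] and eventually exceeds [2 * ln n]. *)
Lemma stretched_exponential_decay (c alpha : R) : 0 < c -> 0 < alpha ->
  \forall n \near \oo, expR (- c * n%:R `^ alpha) <= n%:R `^ (- 2) :> R.
Proof.
move=> c0 a0; near=> n.
have n0 : (0 < n)%N by near: n; exact: nbhs_infty_gt.
have T1 : 4 / (c * alpha ^+ 2) <= ln (n%:R : R) by near: n; exact: near_ln_ge.
have ca : 0 < c * alpha ^+ 2 by rewrite mulr_gt0// exprn_gt0.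
rewrite !powRnE// ler_expR; set t := ln _ in T1 *.
have t0 : 0 <= t by apply: le_trans T1; rewrite divr_ge0// ltW.
have := @expR_ge1Dxn R (alpha * t) 1 (mulr_ge0 (ltW a0) t0).
rewrite (_ : 2`!%:R = 2)// => h.
move: T1; rewrite ler_pdivrMr// => T1.
have : c * (1 + (alpha * t) ^+ 2 / 2) <= c * expR (alpha * t)
  by rewrite ler_pM2l.
have -> : (alpha * t) ^+ 2 / 2 = (alpha ^+ 2 * t) * t / 2 by rewrite exprMn;
  ring.
have : 4 * t <= t * (c * alpha ^+ 2) * t by rewrite ler_wpM2r.
lra.
Unshelve. all: by end_near. Qed.

(** The power [alpha] of [ln n] is [ln n] times its power [alpha - 1], which eventually exceeds
    [2 / - ln eta]. *)
Lemma log_power_decay (eta alpha : R) : 0 < eta -> eta < 1 -> 1 < alpha ->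
  \forall n \near \oo, eta `^ (ln n%:R `^ alpha) <= n%:R `^ (- 2) :> R.
Proof.
move=> eta0 eta1 a1; near=> n.
have n0 : (0 < n)%N by near: n; exact: nbhs_infty_gt.
have lneta : ln eta < 0 by apply: ln_lt0; rewrite eta0 eta1.
have l0 : 0 < - ln eta by rewrite oppr_gt0.
have s0 : 0 < alpha - 1 by rewrite subr_gt0.
pose T := (2 / - ln eta) `^ (alpha - 1)^-1.
have Tn : T <= ln (n%:R : R) by near: n; exact: near_ln_ge.
have n1 : 1 <= ln (n%:R : R) by near: n; exact: near_ln_ge.
rewrite powRnE// /powR gt_eqF// ler_expR -/(powR _ _).
set t := ln _ in Tn n1 *.
have t0 : 0 < t by apply: lt_le_trans n1.
have : 2 / - ln eta <= t `^ (alpha - 1).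
  have -> : 2 / - ln eta = T `^ (alpha - 1).
    by rewrite /T -powRrM mulVf ?gt_eqF// powRr1// divr_ge0// ltW.
  by apply: ge0_ler_powR => //; rewrite ?nnegrE ?powR_ge0// ltW.
rewrite ler_pdivrMr// => h.
have -> : t `^ alpha = t `^ (alpha - 1) * t.
  by rewrite -[X in _ * X]powRr1 ?(ltW t0)// -powRD ?subrK// (gt_eqF t0)
    implybT.
have := ler_wpM2r (ltW t0) h; lra.
Unshelve. all: by end_near. Qed.

End decay_rates.

(** * Potentials satisfying Walters' condition *)

Section walters_potentials.
Context (A : pointedFinType) (R : realType) (phi : Omega A -> R).
Hypothesis phi_walters : walters_condition phi.

Let W (n : nat) : R := fine (variation_seq phi n).

Lemma variation_seq_fin_num p : variation_seq phi p \is a fin_num.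
Proof.
have [fin pos _ _] := phi_walters; rewrite ge0_fin_numE ?ltW//.
apply: le_lt_trans fin; apply: ge_ereal_sup => _ [[x y] /= _ <-].
by apply: ereal_sup_ubound; exists x => //; exists y.
Qed.

Lemma variation_seq_ge0 p : 0 <= W p.
Proof. by have [_ pos _ _] := phi_walters; rewrite fine_ge0// ltW. Qed.

Lemma variation_seq_nonincreasing p : W p.+1 <= W p.
Proof.
have [_ _ dec _] := phi_walters.
by rewrite fine_le ?variation_seq_fin_num//; exact: dec.
Qed.

Lemma variation_seq_distortion s x y m : agree m x y ->
  `|birkhoff_sum phi (size s) (prepend s x)
    - birkhoff_sum phi (size s) (prepend s y)| <= W m.
Proof.
move=> xy; rewrite -lee_fin fineK ?variation_seq_fin_num//.
apply: (@le_trans _ _ (variation phi x y)).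
  by apply: ereal_sup_ubound; exists s.
by apply: ereal_sup_ubound; exists (x, y).
Qed.

Lemma walters_rate_summable (theta : R) : 0 < theta -> theta < 1 ->
  [\/ W =O_\oo (fun n : nat => theta ^+ n),
      exists2 alpha : R, 1 < alpha & W =O_\oo (fun n : nat =>
        n%:R `^ (- alpha)),
      exists eta alpha : R, [/\ 0 < eta, eta < 1, 1 < alpha &
        W =O_\oo (fun n : nat => eta `^ (ln n%:R `^ alpha))] |
      exists c alpha : R, [/\ 0 < c, 0 < alpha, alpha < 1 &
        W =O_\oo (fun n : nat => expR (- c * n%:R `^ alpha))]] ->
  exists S : R, forall N, \sum_(k < N) W k <= S.
Proof.
move=> t0 t1 rate.
suff [alpha a1 [c Wc]] : exists2 alpha : R, 1 < alpha &
    exists c, \forall n \near \oo, W n <= c * n%:R `^ (- alpha).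
  exact: power_decay_summable variation_seq_ge0 a1 Wc.
have a2 : 1 < 2 :> R by rewrite ltr1n.
case: rate => [WO|[alpha a1 WO]|[eta [alpha [eta0 eta1 a1 WO]]]|[c [alpha [c0
  a0 _ WO]]]].
(* [theta ^+ n] is the stretched exponential with exponent 1 and [c = - ln theta]. *)
- exists 2 => //; apply: eqO_power_decay WO _.
  have c0 : 0 < - ln theta by rewrite oppr_gt0 ln_lt0// t0 t1.
  have := stretched_exponential_decay c0 ltr01; apply: filterS => n.
  rewrite opprK powRr1// ger0_norm ?exprn_ge0 ?(ltW t0)//.
  by rewrite -[in theta ^+ n](@lnK _ theta) ?posrE// -expRM_natr mulrC.
- exists alpha => //; apply: eqO_power_decay WO _; apply: nearW => n.
  by rewrite ger0_norm// powR_ge0.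
- exists 2 => //; apply: eqO_power_decay WO _.
  by apply: filterS (log_power_decay eta0 eta1 a1) => n;
    rewrite ger0_norm// powR_ge0.
- exists 2 => //; apply: eqO_power_decay WO _.
  by apply: filterS (stretched_exponential_decay c0 a0) => n;
    rewrite ger0_norm// expR_ge0.
Qed.

(** Of the factor 3, one [W m] is due to [phi], through the word [[:: a]], and two to [H], at the
    points themselves and after adding the letter [a], where they even agree up to [m + 1]. *)
Lemma normalized_potential S : (forall N, \sum_(k < N) W k <= S) ->
  exists (P : R) (H psi : Omega A -> R),
  [/\ ucont H,
      forall x, phi x = psi x + (P + (H (shift x) - H x)),
      forall x, \sum_(a : A) expR (psi (scons a x)) = 1 &
      forall m a x y, agree m x y ->
        `|psi (scons a x) - psi (scons a y)| <= 3 * W m].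
Proof.
move=> WS; have [P [H [_ HW H1]]] := pressure_eigenfunction
  variation_seq_distortion.
exists P, H, (fun x => phi x - P + H x - H (shift x)); split.
- move=> e e0; have [N WN] := summable_nonincreasing_small
    variation_seq_nonincreasing WS e0.
  by exists N => x y /HW /le_trans; exact.
- by move=> x; ring.
- by move=> x; rewrite -(H1 x); apply: eq_bigr => a _; rewrite shift_scons.
move=> m a x y xy; rewrite !shift_scons.
have := variation_seq_distortion [:: a] xy.
rewrite /= !prepend_cons !prepend_nil !birkhoff_sum_scons !birkhoff_sum0 !addr0.
have := HW _ _ _ xy; have := HW _ _ _ (agree_scons a xy).
have := variation_seq_nonincreasing m.
rewrite !ler_norml => ? /andP[? ?] /andP[? ?] /andP[? ?]; apply/andP; split;
  lra.
Qed.

End walters_potentials.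

(** * Identification of the equilibrium state and conclusion *)

Theorem theorem3p1 (A : pointedFinType) (R : realType) (theta : R)
    (theta_gt0 : 0 < theta) (theta_lt1 : theta < 1)
    (phi : Omega A -> R) (phi_cont : continuous phi)
    (phi_walters : walters_condition phi)
    (phi_rate :
      let W := fun n : nat => fine (variation_seq phi n) in
      [\/ W =O_\oo (fun n : nat => theta ^+ n),
          exists2 alpha : R, 1 < alpha &
            W =O_\oo (fun n : nat => n%:R `^ (- alpha)),
          exists eta alpha : R, [/\ 0 < eta, eta < 1, 1 < alpha &
            W =O_\oo (fun n : nat => eta `^ (ln n%:R `^ alpha))] |
          exists c alpha : R, [/\ 0 < c, 0 < alpha, alpha < 1 &
            W =O_\oo (fun n : nat => expR (- c * n%:R `^ alpha))]])
    (mu : probability (Omega A) R)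
    (mu_eq : unique_equilibrium_state phi mu) :
  exists2 C : R, 0 < C &
    forall (n : nat) (K : ('I_n -> Omega A) -> R),
      (1 <= n)%N -> separately_lipschitz theta K ->
      (\int[mu]_x (expR (K (orbit_segment n x)))%:E <=
       expeR (\int[mu]_x (K (orbit_segment n x))%:E) *
       (expR (C * \sum_(j < n) Lip theta K j ^+ 2))%:E)%E.
Proof.
have [S WS] := walters_rate_summable phi_walters theta_gt0 theta_lt1 phi_rate.
have [P [H [psi [uH phiE psi1 psi_eta]]]] := normalized_potential phi_walters
  WS.
pose eta m := 3 * fine (variation_seq phi m).
have eta_nincr m : eta m.+1 <= eta m.
  by rewrite ler_wpM2l// (variation_seq_nonincreasing phi_walters).
have sum_eta N : \sum_(k < N) eta k <= 3 * S.
  by rewrite -mulr_sumr ler_wpM2l.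
have [mu0 mu0_gint] := g_measure_exists psi1 psi_eta eta_nincr sum_eta.
have inv0 := g_measure_shift_invariant psi1 psi_eta eta_nincr sum_eta mu0_gint.
have bpsi := ucont_bounded_measurable (g_function_ucont psi_eta eta_nincr
  sum_eta).
have bH := ucont_bounded_measurable uH.
(* The coboundary of [H] has mean 0 for every invariant measure. *)
have mean_phi nu : shift_invariant nu ->
    (\int[nu]_x (phi x)%:E)%E = (\int[nu]_x psi x + P)%:E.
  move=> inv.
  have bHs := ucont_bounded_measurable (ucont_shift uH).
  have bP := bounded_measurable_cst (Omega A) P.
  have bNH := bounded_measurableZ (-1) bH.
  have b1 := bounded_measurableD bHs bNH.
  have b2 := bounded_measurableD bP b1.
  have phi_fun : phi = fun x => psi x + (P + (H (shift x) + -1 * H x)).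
    by apply/funext => x; rewrite phiE mulN1r.
  rewrite phi_fun (Rintegral_EFin nu (bounded_measurableD bpsi b2)).
  rewrite (meanD nu bpsi b2) (meanD nu bP b1) (meanD nu bHs bNH) (meanZ nu _
    bH).
  by rewrite mean_cst (mean_shift inv bH) mulN1r subrr addr0.
(* The entropy bound makes every free energy at most [P], and its case of equality gives [P] for
   [mu0]. *)
have eq0 : equilibrium_state phi mu0.
  split => // nu inv; rewrite /free_energy !mean_phi//.
  rewrite (ks_entropy_g_measure psi1 psi_eta eta_nincr sum_eta mu0_gint).
  rewrite -EFinD addrA addNr add0r.
  apply: le_trans (leeD2r _ (ks_entropy_le psi1 psi_eta eta_nincr sum_eta inv))
    _.
  by rewrite -EFinD addrA addNr add0r.
have muE B : measurable B -> mu B = mu0 B.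
  by move=> mB; rewrite (mu_eq.2 _ eq0).
pose D := house_bound (3 * S) theta.
have D_gt0 : 0 < D by rewrite mulr_gt0 ?expR_gt0// invr_gt0 subr_gt0.
exists (2 * D ^+ 2) => [|n K _ K_lip]; first by rewrite mulr_gt0// exprn_gt0.
have intE (f : Omega A -> R) : ucont f ->
    (\int[mu]_x (f x)%:E)%E = (gint psi f)%:E.
  move=> uf; rewrite -(mean_gint psi1 psi_eta eta_nincr sum_eta mu0_gint uf).
  rewrite -(Rintegral_EFin _ (ucont_bounded_measurable uf)).
  by apply: eq_measure_integral => B mB _; exact: muE.
pose F x := K (orbit_segment n x).
have F_lip x y : `|F x - F y| <= \sum_(j < n) Lip theta K j *
    dist theta (iter j (@Defs.shift A) x) (iter j (@Defs.shift A) y).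
  exact: Lip_sum K_lip _ _.
have L0 := Lip_ge0 K_lip.
have uF := orbit_lipschitz_ucont theta_gt0 theta_lt1 L0 F_lip.
rewrite (intE _ (ucont_expR uF)) (intE _ uF) /= -EFinM lee_fin mulrC.
exact: (gint_expR_le psi1 psi_eta eta_nincr sum_eta theta_gt0 theta_lt1 L0
  F_lip).
Qed.
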